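(* Let $(X,|\cdot|)$ be a compact metric space and let $\{\mathcal A,\mathcal H,ds\}$ be a spectral geometry on $X$. Then its support $B$ is contained in $X^2\setminus\Delta$ and satisfies: (a) $B$ is symmetric, i.e. $(y,y')\in B\Leftrightarrow (y',y)\in B$; (b) the set $B_t=\{(y,y')\in B: |yy'|\ge t\}$ is finite for each $t>0$. Moreover, there exists a symmetric function $m:B\to\mathbb N$ (i.e. $m(y,y')=m(y',y)$ for all $(y,y')\in B$) for which $\{\mathcal A,\mathcal H,ds\}$ is isomorphic to the spectral geometry $M(B,m)=\{\mathcal A,\mathcal H',ds'\}$ by an isometry $U:\mathcal H\to\mathcal H'$ conjugating the representations of $\mathcal A$ and the operators $ds$, $ds'$.
   Context: $|xy|$ denotes the distance in $X$, $\Delta=\{(x,x):x\in X\}$ is the diagonal of $X^2=X\times X$, and $\mathbb N$ is the set of positive integers. Spectral measure on $X^2$: an operator-valued function $P$ defined on the Borel subsets of $X^2$ such that $P(A)$ is an orthogonal projector in a fixed Hilbert space $\mathcal H$ for every Borel $A\subset X^2$, and $A\mapsto (P(A)\xi,\xi)$ is a Borel measure on $X^2$ for every $\xi\in\mathcal H$. In particular, $P(A_1\cup A_2)=P(A_1)+P(A_2)$ and $P(A_1)P(A_2)=0$ for $A_1\cap A_2=\emptyset$. Spectral geometry on $X$: it is given by an involutive representation $\pi$ of the algebra $\mathcal A$ of Lipschitz functions on $X$ in a Hilbert space $\mathcal H$ and an injective compact self-adjoint operator $ds$ on $\mathcal H$ such that conditions (i)–(iv) hold. (i) $\pi$ is the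 restriction to $\mathcal A$ of an involutive representation $\widetilde\pi$ of the $C^*$-algebra of continuous functions on $X^2$, where $a\in\mathcal A$ is considered as the continuous function $a(x,x')=a(x)$ on $X^2$. Let $P$ be the spectral measure on $X^2$ corresponding to $\widetilde\pi$, i.e. $\widetilde\pi(a)=\int_{X^2}a(x,x')\,dP(x,x')$ for every continuous $a$ on $X^2$. (ii) $ds\circ P(A)=P(\gamma(A))\circ ds$ for every Borel subset $A\subset X^2$, where $\gamma(x,x')=(x',x)$. For an eigenvalue $\lambda$ of $ds$ let $L_\lambda$ be the eigenspace of $ds^2$ corresponding to the eigenvalue $\lambda^2$, and let $A_\lambda=A_{-\lambda}$ be the union of all open subsets $A\subset X^2$ for which $P(A)$ is a projector on a subspace orthogonal to $L_\lambda$. (iii) $P(A_\lambda)$ is the projector onto the orthogonal complement $L_\lambda^\perp$ of $L_\lambda$ for each eigenvalue $\lambda$ of $ds$. Put $\Lambda_\lambda=X^2\setminus A_\lambda$. (iv) $|yy'|=|\lambda|$ for every $(y,y')\in\Lambda_\lambda$ (for each eigenvalue $\lambda$ of $ds$). The support of the spectral geometry is $B=\bigcup_\lambda\Lambda_\lambda$, where $\lambda$ runs over all eigenvalues of $ds$. The triple $M(B,m)$: for $B\subset X^2\setminus\Delta$ satisfying (a), (b) and a symmetric function $m:B\to\mathbb N$, the Hilbert space $\mathcal H'$ consists of the sections $\xi$ over $B$ with $\xi(y,y')\in\mathbb C^{m(y,y')}$ and $\sum_{(y,y')\in B}\|\xi(y,y')\|^2<\infty$; the algebra $\mathcal A$ acts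 by $(\pi'(a)\xi)(y,y')=a(y)\xi(y,y')$; and $(ds'\xi)(y,y')=|yy'|\,\xi(y',y)$ (well defined since $m$ is symmetric).
   Formalization: The involutive representations of the Lipschitz functions and of the continuous functions on X² are required to be unital (1 acts as the identity); without this the claim fails, e.g. for zero representations and P = 0 on the complex line with ds the identity. *)

(* Defs.v *)
From HB Require Import structures.
From mathcomp Require Import all_boot all_order all_algebra complex.
From mathcomp Require Import all_classical all_reals all_analysis.

Set Implicit Arguments.
Unset Strict Implicit.
Unset Printing Implicit Defensive.

Import Order.TTheory GRing.Theory Num.Theory.
Import numFieldNormedType.Exports.

Local Open Scope classical_set_scope.
Local Open Scope ring_scope.
Local Open Scope complex_scope.

Definition borel_set {T : topologicalType} : set (set T) := <<s @open T >>.

(* The measurable types of the library are pointed; [borel t0] is [T] with its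
   Borel sigma-algebra, where [t0] only serves as the required point.  The
   definitions below quantify over all [t0], so that [T] may be empty. *)
Definition borel {T : topologicalType} (t0 : T) : Type := T.

Section borel_instances.
Context {T : topologicalType} (t0 : T).

Let borelC (A : set T) : borel_set A -> borel_set (~` A).
Proof. by move=> bA; rewrite -setTD; exact: sigma_algebraCD. Qed.

HB.instance Definition _ := Choice.copy (borel t0) T.
HB.instance Definition _ := isPointed.Build (borel t0) t0.
HB.instance Definition _ := @isMeasurable.Build (sigma_display (@open T))
  (borel t0) (@borel_set T) (@sigma_algebra0 _ setT (@open T)) borelC
  (@sigma_algebra_bigcup _ setT (@open T)).

End borel_instances.

Definition cintegral {R : realType} {d : measure_display} {T : measurableType d}
    (mu : {measure set T -> \bar R}) (f : T -> R[i]) : R[i] :=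
  (\int[mu]_z complex.Re (f z))%R +i* (\int[mu]_z complex.Im (f z))%R.

(* A Hilbert space is a complete normed space [H] over [R[i]] together with an
   inner product [dot], linear in its first argument, which induces the norm. *)

Definition hilbert_dot {R : realType} {H : completeNormedModType R[i]}
    (dot : {dot H for (@Num.conj R[i])}) : Prop :=
  forall x : H, dot x x = `|x| ^+ 2.

Section operators.
Context {R : realType} {H : completeNormedModType R[i]}.
Variable dot : {dot H for (@Num.conj R[i])}.
Implicit Types (p T : {linear H -> H}) (V : set H).

Definition self_adjoint T : Prop := forall x y, dot (T x) y = dot x (T y).

Definition compact_operator T : Prop :=
  precompact (T @` [set x : H | `|x| <= 1]).

Definition op_eigenvalue T (lambda : R[i]) : Prop :=
  exists x : H, x != 0 /\ T x = lambda *: x.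

Definition orthocomplement V : set H :=
  [set x : H | forall y, V y -> dot x y = 0].

Definition orthogonal_projector p : Prop :=
  (forall x, p (p x) = p x) /\ self_adjoint p.

Definition projector_onto p V : Prop :=
  orthogonal_projector p /\ range p = V.

(* [rho] is an involutive unital representation by bounded operators of the
   algebra [D] of complex functions on [S]; its values outside [D] are
   irrelevant. *)
Record involutive_representation {S : Type} (D : set (S -> R[i]))
    (rho : (S -> R[i]) -> {linear H -> H}) : Prop := {
  rep_bounded : forall a, D a -> continuous (rho a) ;
  rep_add : forall a b, D a -> D b -> forall x,
    rho (fun s => a s + b s) x = rho a x + rho b x ;
  rep_scale : forall (k : R[i]) a, D a -> forall x,
    rho (fun s => k * a s) x = k *: rho a x ;
  rep_mul : forall a b, D a -> D b -> forall x,
    rho (fun s => a s * b s) x = rho a (rho b x) ;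
  rep_one : forall x, rho (fun=> 1) x = x ;
  rep_conj : forall a, D a -> forall x y,
    dot (rho (fun s => Num.conj (a s)) x) y = dot x (rho a y) }.

(* [mu] is the measure [A |-> (P(A) xi, xi)]; the inner product is real when
   [P(A)] is an orthogonal projector. *)
Definition scalar_measure {S : topologicalType} (s0 : S)
    (P : set S -> {linear H -> H}) (xi : H)
    (mu : {measure set (borel s0) -> \bar R}) : Prop :=
  forall A : set S, borel_set A -> mu A = (complex.Re (dot (P A xi) xi))%:E.

(* The values of [P] outside the Borel sets are irrelevant. *)
Record spectral_measure {S : topologicalType}
    (P : set S -> {linear H -> H}) : Prop := {
  sm_projector : forall A, borel_set A -> orthogonal_projector (P A) ;
  sm_measure : forall (s0 : S) (xi : H),
    exists mu : {measure set (borel s0) -> \bar R}, scalar_measure P xi mu }.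

(* [T] is the operator [\int a dP], characterized by its quadratic form. *)
Definition is_spectral_integral {S : topologicalType}
    (P : set S -> {linear H -> H}) (a : S -> R[i]) T : Prop :=
  forall (s0 : S) (xi : H) (mu : {measure set (borel s0) -> \bar R}),
    scalar_measure P xi mu -> dot (T xi) xi = cintegral mu a.

End operators.

Definition lipschitz_functions {R : realType} (X : metricType R) :
    set (X -> R[i]) :=
  [set a | exists k : R, forall x y : X, `|a x - a y| <= (k * mdist x y)%:C].

Definition continuous_functions (R : realType) (S : topologicalType) :
    set (S -> R[i]) :=
  [set a | continuous (a : S -> R[i]^o)].

Section open_set_and_support.
Context {R : realType} {X : metricType R} {H : completeNormedModType R[i]}.
Variables (dot : {dot H for (@Num.conj R[i])}) (ds : {linear H -> H}).
Variable P : set (X * X) -> {linear H -> H}.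

Definition sq_eigenspace (lambda : R[i]) : set H :=
  [set x | ds (ds x) = lambda ^+ 2 *: x].

Definition A_set (lambda : R[i]) : set (X * X) :=
  \bigcup_(A in [set A | open A /\
    range (P A) `<=` orthocomplement dot (sq_eigenspace lambda)]) A.

Definition Lambda_set (lambda : R[i]) : set (X * X) := ~` A_set lambda.

Definition support_set : set (X * X) :=
  \bigcup_(lambda in [set l | op_eigenvalue ds l]) Lambda_set lambda.

End open_set_and_support.

Record spectral_geometry (R : realType) (X : metricType R)
    (H : completeNormedModType R[i]) (dot : {dot H for (@Num.conj R[i])}) :=
  SpectralGeometry {
  sg_pi : (X -> R[i]) -> {linear H -> H} ;
  sg_ds : {linear H -> H} ;
  sg_pi_tilde : (X * X -> R[i]) -> {linear H -> H} ;
  sg_P : set (X * X) -> {linear H -> H} ;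
  sg_pi_rep : involutive_representation dot (@lipschitz_functions R X) sg_pi ;
  sg_ds_injective : injective sg_ds ;
  sg_ds_compact : compact_operator sg_ds ;
  sg_ds_self_adjoint : self_adjoint dot sg_ds ;
  sg_pi_tilde_rep : involutive_representation dot
    (@continuous_functions R (X * X)%type) sg_pi_tilde ;
  sg_pi_restriction : forall a, lipschitz_functions a ->
    forall xi, sg_pi a xi = sg_pi_tilde (fun z => a z.1) xi ;
  sg_P_spectral : spectral_measure dot sg_P ;
  sg_pi_tilde_integral : forall a : X * X -> R[i], continuous_functions a ->
    is_spectral_integral dot sg_P a (sg_pi_tilde a) ;
  sg_ds_P : forall A : set (X * X), borel_set A ->
    forall xi, sg_ds (sg_P A xi) = sg_P (swap_pair @` A) (sg_ds xi) ;
  sg_A_projector : forall lambda, op_eigenvalue sg_ds lambda ->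
    projector_onto dot (sg_P (A_set dot sg_ds sg_P lambda))
      (orthocomplement dot (sq_eigenspace sg_ds lambda)) ;
  sg_Lambda_dist : forall lambda, op_eigenvalue sg_ds lambda ->
    forall y y' : X, Lambda_set dot sg_ds sg_P lambda (y, y') ->
      (mdist y y')%:C = `|lambda| }.

Definition sg_support {R : realType} {X : metricType R}
    {H : completeNormedModType R[i]} {dot : {dot H for (@Num.conj R[i])}}
    (G : spectral_geometry X dot) : set (X * X) :=
  support_set dot (sg_ds G) (sg_P G).

Section model.
Context {R : realType} {X : metricType R}.
Variables (B : set (X * X)) (m : X * X -> nat).

(* The space C^(m p) is the space of sequences vanishing from rank [m p] on, so
   that values at [(y, y')] and at [(y', y)] can be compared without a cast. *)
Definition sections : Type := X * X -> nat -> R[i]^o.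

Definition is_section (xi : sections) : Prop :=
  forall p k, ~ (B p /\ (k < m p)%N) -> xi p k = 0.

Definition model_sqnorm (xi : sections) : \bar R :=
  \esum_(p in B) (\sum_(k < m p) complex.Re (`|xi p k| ^+ 2))%:E.

Definition model_space : set sections :=
  [set xi | is_section xi /\ (model_sqnorm xi < +oo)%E].

Definition model_pi (a : X -> R[i]) (xi : sections) : sections :=
  fun p k => a p.1 * xi p k.

Definition model_ds (xi : sections) : sections :=
  fun p k => (mdist p.1 p.2)%:C * xi (swap_pair p) k.

End model.

(* [U] is an isometry of [H] onto the Hilbert space of M(B, m). *)
Record model_isomorphism {R : realType} {X : metricType R}
    {H : completeNormedModType R[i]} {dot : {dot H for (@Num.conj R[i])}}
    (G : spectral_geometry X dot) (B : set (X * X)) (m : X * X -> nat)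
    (U : {linear H -> @sections R X}) : Prop := {
  iso_onto : range U = model_space B m ;
  iso_norm : forall xi, model_sqnorm B m (U xi) = (complex.Re (dot xi xi))%:E ;
  iso_pi : forall a, lipschitz_functions a ->
    forall xi, U (sg_pi G a xi) = model_pi a (U xi) ;
  iso_ds : forall xi, U (sg_ds G xi) = model_ds (U xi) }.

(* Main.v *)
(** Every spectral projection of a point of the support is nonzero: the
    projections of shrinking balls around [z \in Lambda_lambda] contain unit
    vectors of the eigenspace [L_lambda], which by compactness of [ds] cluster at
    a nonzero vector fixed by all of them, hence by [P({z})].  On the range of
    [P({z})] one has [ds^2 = |z|^2], and [ds] maps it into the range of
    [P({swap z})].  As [ds] is compact it has no infinite orthonormal sequence of
    such eigenvectors with [|z|] bounded below; this yields the finiteness of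
    [B_t] and of each multiplicity [m z].  The spectral theorem for [ds] and the
    finiteness of [Lambda_lambda] show that these ranges span a dense subspace,
    and [U] takes coefficients in an orthonormal basis of each range, chosen on
    one point of every pair [{z, swap z}] and transported by [ds / |z|]. *)
Require Import Defs.
From HB Require Import structures.
From mathcomp Require Import all_boot all_order all_algebra complex.
From mathcomp Require Import all_classical all_reals all_analysis.
From mathcomp Require Import measurable_realfun.
From mathcomp Require Import ring lra.

Set Implicit Arguments.
Unset Strict Implicit.
Unset Printing Implicit Defensive.

Import Order.TTheory GRing.Theory Num.Theory.
Import numFieldNormedType.Exports.

Local Open Scope classical_set_scope.
Local Open Scope ring_scope.
Local Open Scope complex_scope.

(** * Inner products and orthogonal projectors *)

(* The norm of a normed space over [R[i]] is a nonnegative element of [R[i]];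
   [nm] reads it as a real number. *)
Definition nm {R : realType} {V : normedModType R[i]} (x : V) : R :=
  complex.Re `|x|.

Section Norm.
Context {R : realType} {V : normedModType R[i]}.
Implicit Types (x y : V).

Lemma nmE x : `|x| = (nm x)%:C.
Proof. by rewrite /nm RRe_real// ger0_real. Qed.

Lemma nm_ge0 x : 0 <= nm x.
Proof. by rewrite -ler0c -nmE. Qed.

Lemma nm0 : nm (0 : V) = 0.
Proof. by rewrite /nm normr0. Qed.

Lemma nm_eq0 x : nm x = 0 -> x = 0.
Proof. by move=> x0; apply: normr0_eq0; rewrite nmE x0. Qed.

Lemma nm_gt0 x : x != 0 -> 0 < nm x.
Proof.
move=> x0; rewrite lt_neqAle nm_ge0 andbT eq_sym; apply: contra x0 => /eqP.
by move/nm_eq0 => ->.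
Qed.

Lemma nmN x : nm (- x) = nm x.
Proof. by rewrite /nm normrN. Qed.

Lemma nmBC x y : nm (x - y) = nm (y - x).
Proof. by rewrite /nm distrC. Qed.

Lemma nmD x y : nm (x + y) <= nm x + nm y.
Proof. by rewrite -lecR rmorphD/= -!nmE ler_normD. Qed.

Lemma nm_tri y x z : nm (x - z) <= nm (x - y) + nm (y - z).
Proof. by rewrite -[X in nm X](subrKA y) nmD. Qed.

Lemma nm_lerB x y : nm x - nm y <= nm (x - y).
Proof. by rewrite lerBlDr (le_trans _ (nmD _ _))// subrK. Qed.

Lemma nmZ (c : R[i]) x : nm (c *: x) = complex.Re `|c| * nm x.
Proof.
by apply: complexI; rewrite rmorphM/= -nmE normrZ nmE RRe_real// ger0_real.
Qed.

Lemma nmZr (c : R) x : nm (c%:C *: x) = `|c| * nm x.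
Proof. by rewrite nmZ normc_def/= expr0n/= addr0 sqrtr_sqr. Qed.

Lemma nm_normalized x : x != 0 -> nm ((nm x)^-1%:C *: x) = 1.
Proof.
move=> x0; have nx := nm_gt0 x0.
by rewrite nmZr ger0_norm ?invr_ge0 ?ltW// mulVf// gt_eqF.
Qed.

End Norm.

Section Hilbert.
Context {R : realType} {H : completeNormedModType R[i]}.
Variable dot : {dot H for (@Num.conj R[i])}.
Hypothesis dotN : hilbert_dot dot.
Implicit Types (x y z v : H) (T p : {linear H -> H}).

Lemma dotC x y : dot x y = (dot y x)^*.
Proof. by have := hermC dot x y; rewrite mul1r. Qed.

Lemma dotDl x y z : dot (x + y) z = dot x z + dot y z.
Proof. exact: linearDl. Qed.

Lemma dotBl x y z : dot (x - y) z = dot x z - dot y z.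
Proof. exact: linearBl. Qed.

Lemma dotZl c x y : dot (c *: x) y = c * dot x y.
Proof. exact: linearZl_LR. Qed.

Lemma dot0l x : dot 0 x = 0.
Proof. exact: linear0l. Qed.

Lemma dotDr x y z : dot z (x + y) = dot z x + dot z y.
Proof. exact: linearDr. Qed.

Lemma dotBr x y z : dot z (x - y) = dot z x - dot z y.
Proof. exact: linearBr. Qed.

Lemma dotZr c x y : dot y (c *: x) = c^* * dot y x.
Proof. exact: linearZr_LR. Qed.

Lemma dot0r x : dot x 0 = 0.
Proof. exact: linear0r. Qed.

Lemma dot_eq0C x y : dot x y = 0 -> dot y x = 0.
Proof. by move=> xy; rewrite dotC xy rmorph0. Qed.

Lemma dotxx x : dot x x = (nm x ^+ 2)%:C.
Proof. by rewrite dotN nmE rmorphXn. Qed.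

Lemma dotZ_real (r : R) x y : dot x (r%:C *: y) = r%:C * dot x y.
Proof. by rewrite dotZr -[(_ ^*)%R]/(_ ^*)%C conjc_real. Qed.

Lemma nm_pythagoras x y : dot x y = 0 ->
  nm (x + y) ^+ 2 = nm x ^+ 2 + nm y ^+ 2.
Proof.
move=> xy; apply: complexI; rewrite rmorphD/= -!dotxx dotDl !dotDr xy.
by rewrite (dot_eq0C xy) addr0 add0r.
Qed.

Lemma nm_pythagorasB x y : dot x y = 0 ->
  nm (x - y) ^+ 2 = nm x ^+ 2 + nm y ^+ 2.
Proof.
move=> xy; rewrite nm_pythagoras ?nmN//.
by rewrite -[- y]sub0r dotBr xy dot0r subrr.
Qed.

(** The component [a *: y] of [x] along [y] is no longer than [x] by Pythagoras, and [|dot x y|] is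
    its length times that of [y]. *)
Lemma cauchy_schwarz x y : `|dot x y| <= (nm x * nm y)%:C.
Proof.
have [->|y0] := eqVneq y 0; first by rewrite dot0r normr0 nm0 mulr0.
have y2 : (nm y ^+ 2)%:C != 0 :> R[i].
  by rewrite (inj_eq (@complexI R) _ 0) expf_neq0// gt_eqF// nm_gt0.
pose a := dot x y / (nm y ^+ 2)%:C.
have oy : dot (x - a *: y) (a *: y) = 0.
  by rewrite dotZr dotBl dotZl dotxx divfK// subrr mulr0.
have := nm_pythagoras oy; rewrite subrK => e.
have : nm (a *: y) ^+ 2 <= nm x ^+ 2 by rewrite e lerDr sqr_ge0.
rewrite ler_pXn2r ?nnegrE ?nm_ge0// => le.
have -> : `|dot x y| = (nm (a *: y) * nm y)%:C.
  rewrite rmorphM/= -!nmE normrZ -mulrA -expr2 (nmE y) -rmorphXn/= /a normrM.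
  by rewrite normfV (ger0_norm (_ : 0 <= (nm y ^+ 2)%:C)) ?ler0c ?sqr_ge0// divfK.
by rewrite lecR ler_wpM2r// nm_ge0.
Qed.

(** Carries orthogonality to limits: an error [x - y] contributes at most its norm times [nm v], by
    Cauchy-Schwarz. *)
Lemma dot_approx0 x v :
  (forall e : R, 0 < e -> exists y, nm (x - y) <= e /\ `|dot y v| <= e%:C) ->
  dot x v = 0.
Proof.
move=> xv; apply: normr0_eq0.
set c := `|_|; have cE : c = (complex.Re c)%:C by rewrite RRe_real// /c ger0_real.
have c0 : 0 <= complex.Re c by rewrite -ler0c -cE /c.
rewrite cE; congr _%:C; apply/eqP; rewrite eq_le c0 andbT.
apply/ler_addgt0Pl => e e0; rewrite addr0.
(* The summand 1 keeps the divisor positive when [v] is zero and also absorbs the second error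
   term. *)
have [|y [xy yv]] := xv (e / (nm v + 1)).
  by rewrite divr_gt0// ltr_wpDl// nm_ge0.
have v1 : 0 < nm v + 1 by rewrite ltr_wpDl// nm_ge0.
rewrite -lecR -cE /c -[x](subrK y) dotDl (le_trans (ler_normD _ _))//.
rewrite (le_trans (lerD (cauchy_schwarz _ _) yv))// -rmorphD/= lecR.
rewrite (le_trans (lerD (ler_wpM2r (nm_ge0 _) xy) (lexx _)))//.
by set d := e / _; rewrite -[X in _ + X <= _]mulr1 -mulrDr divfK// gt_eqF.
Qed.

Lemma dot_eq0 x : (forall y, dot x y = 0) -> x = 0.
Proof.
move=> x0; apply: nm_eq0; have /complexI/eqP := etrans (esym (dotxx x)) (x0 x).
by rewrite sqrf_eq0 => /eqP.
Qed.

Section Projector.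
Variable p : {linear H -> H}.
Hypothesis pP : orthogonal_projector dot p.

Lemma proj_dot x : dot (p x) x = (nm (p x) ^+ 2)%:C.
Proof. by case: pP => pp psa; rewrite -dotxx -psa pp. Qed.

Lemma proj_pythagoras x : nm x ^+ 2 = nm (p x) ^+ 2 + nm (x - p x) ^+ 2.
Proof.
case: pP => pp psa.
rewrite -nm_pythagoras; first by rewrite addrC subrK.
by rewrite psa linearB/= pp subrr dot0r.
Qed.

Lemma proj_le x : nm (p x) <= nm x.
Proof.
rewrite -(@ler_pXn2r _ 2)// ?nnegrE ?nm_ge0// [leRHS]proj_pythagoras.
by rewrite lerDl sqr_ge0.
Qed.

(** By Pythagoras, a projector that does not shorten [x] leaves no defect [x - p x]. This turns
    statements about masses into equalities of vectors. *)
Lemma proj_fix x : nm x ^+ 2 <= nm (p x) ^+ 2 -> p x = x.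
Proof.
rewrite [leLHS]proj_pythagoras gerDl => le0; apply/eqP; rewrite eq_sym -subr_eq0.
apply/eqP/nm_eq0/eqP; rewrite -sqrf_eq0; apply/eqP/le_anti.
by rewrite le0 sqr_ge0.
Qed.

(** The range of a projector is closed, because [p] contracts the error [y - x]. *)
Lemma proj_approx x :
  (forall e : R, 0 < e -> exists y, nm (x - y) <= e /\ p y = y) -> p x = x.
Proof.
move=> h; apply/eqP; rewrite eq_sym -subr_eq0; apply/eqP/nm_eq0/le_anti.
rewrite nm_ge0 andbT; apply/ler_addgt0Pl => e e0; rewrite addr0.
have [|y [xy py]] := h (e / 2); first exact: divr_gt0.
rewrite (le_trans (nm_tri y _ _))// [leRHS](splitr e) lerD//.
by rewrite -{1}py -linearB/= (le_trans (proj_le _))// nmBC.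
Qed.

End Projector.

End Hilbert.

(** * Spectral measures *)

Section SpectralMeasure.
Context {R : realType} {H : completeNormedModType R[i]}.
Variable dot : {dot H for (@Num.conj R[i])}.
Hypothesis dotN : hilbert_dot dot.
Context {S : topologicalType}.
Variables (s0 : S) (P : set S -> {linear H -> H}).
Hypothesis PP : spectral_measure dot P.
Implicit Types (A B C : set S) (x y : H).

Lemma borel_open A : open A -> borel_set A.
Proof. by move=> oA; apply: sub_sigma_algebra. Qed.

Lemma borel_closed A : closed A -> borel_set A.
Proof.
move=> cA; rewrite -[A]setCK.
by apply: (@measurableC _ (borel s0)); apply: borel_open; rewrite openC.
Qed.

Lemma borel_setI A B : borel_set A -> borel_set B -> borel_set (A `&` B).
Proof. by move=> bA bB; exact: (@measurableI _ (borel s0)). Qed.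

Lemma scalar_measureE x : exists mu : {measure set (borel s0) -> \bar R},
  scalar_measure dot P x mu /\
  forall A, borel_set A -> mu A = (nm (P A x) ^+ 2)%:E.
Proof.
have [mu muP] := sm_measure PP s0 x; exists mu; split=> // A bA.
by rewrite muP// (proj_dot dotN (sm_projector PP bA)).
Qed.

Lemma spectral_setU A B x : borel_set A -> borel_set B -> A `&` B = set0 ->
  nm (P (A `|` B) x) ^+ 2 = nm (P A x) ^+ 2 + nm (P B x) ^+ 2.
Proof.
move=> bA bB AB; have [mu [_ muE]] := scalar_measureE x.
apply: EFin_inj; rewrite EFinD -!muE//; last exact: (@measurableU _ (borel s0)).
exact: measureU.
Qed.

(** The vector [P A x] already has its full squared norm as mass on [A]. Its mass on the union
    cannot exceed that, so nothing is left for [B]. *)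
Lemma spectral_disjoint A B x : borel_set A -> borel_set B -> A `&` B = set0 ->
  P B (P A x) = 0.
Proof.
move=> bA bB AB; have [pA _] := sm_projector PP bA.
have bAB : borel_set (A `|` B) by exact: (@measurableU _ (borel s0)).
have := spectral_setU (P A x) bA bB AB; rewrite pA => e.
have := proj_le dotN (sm_projector PP bAB) (P A x).
rewrite -(@ler_pXn2r _ 2)// ?nnegrE ?nm_ge0// e gerDl => le0.
by apply/nm_eq0/eqP; rewrite -sqrf_eq0; apply/eqP/le_anti; rewrite le0 sqr_ge0.
Qed.

(** The mass of [P A x] on [C] is at least its mass on [A], which is its full squared norm, so
    [proj_fix] applies. *)
Lemma spectral_sub A C x : borel_set A -> borel_set C -> A `<=` C ->
  P C (P A x) = P A x.
Proof.
move=> bA bC AC; have [pA _] := sm_projector PP bA.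
have bD : borel_set (C `\` A) by exact: (@measurableD _ (borel s0)).
apply: (proj_fix dotN (sm_projector PP bC)).
have := spectral_setU (P A x) bA bD (setDIK _ _).
by rewrite setDUK// pA => ->; rewrite lerDl sqr_ge0.
Qed.

Lemma spectral_fix_sub A C x : borel_set A -> borel_set C -> A `<=` C ->
  P A x = x -> P C x = x.
Proof. by move=> bA bC AC <-; exact: spectral_sub. Qed.

Lemma spectral_sub_r A C x : borel_set A -> borel_set C -> A `<=` C ->
  P A (P C x) = P A x.
Proof.
move=> bA bC AC; have [_ saA] := sm_projector PP bA.
have [_ saC] := sm_projector PP bC.
apply/eqP; rewrite -subr_eq0; apply/eqP/(dot_eq0 dotN) => y.
by rewrite dotBl !saA saC spectral_sub// subrr.
Qed.

Lemma spectral_null_sub A C x : borel_set A -> borel_set C -> A `<=` C ->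
  P C x = 0 -> P A x = 0.
Proof.
by move=> bA bC AC PCx; rewrite -(@spectral_sub_r A C)// PCx linear0.
Qed.

(** Countable unions of negligible sets are negligible for the scalar measure of [x]. *)
Lemma spectral_null_bigcup (A : nat -> set S) x :
  (forall n, borel_set (A n)) -> (forall n, P (A n) x = 0) ->
  P (\bigcup_n A n) x = 0.
Proof.
move=> bA PA0; have [mu [_ muE]] := scalar_measureE x.
have bU : borel_set (\bigcup_n A n).
  exact: (@bigcupT_measurable _ (borel s0)).
have : mu.-negligible (\bigcup_n A n).
  apply: negligible_bigcup => n; exists (A n); split=> //.
  - exact: bA.
  - by apply: etrans (muE _ (bA n)) _; rewrite PA0 nm0 expr0n.
move=> /(negligibleP mu bU) mU0; have := etrans (esym (muE _ bU)) mU0.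
by move=> -[] /eqP; rewrite sqrf_eq0 => /eqP/nm_eq0.
Qed.

(** The remainder [x - P A x] has no mass on [A], hence is fixed by the projector of the complement,
    which in turn kills [P A x]. *)
Lemma spectral_setC A x : (forall x, P setT x = x) -> borel_set A ->
  P (~` A) x = x - P A x.
Proof.
move=> PT bA; have bC : borel_set (~` A) by exact: (@measurableC _ (borel s0)).
have [pA _] := sm_projector PP bA.
have PCA : P (~` A) (P A x) = 0.
  by apply: spectral_disjoint; rewrite ?setICr.
have PAw : P A (x - P A x) = 0 by rewrite linearB/= pA subrr.
have := spectral_setU (x - P A x) bA bC (setICr _).
rewrite setUv PT PAw nm0 expr0n/= add0r => e.
have := @proj_fix _ _ _ dotN _ (sm_projector PP bC) (x - P A x).
by rewrite -e linearB/= PCA subr0; apply.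
Qed.

End SpectralMeasure.

(** * Integration against a measure carried by a point *)

Lemma continuous_borel_measurable {R : realType} {S : topologicalType} (s0 : S)
    (g : S -> R) :
  continuous g -> measurable_fun [set: borel s0] (g : borel s0 -> R).
Proof.
move=> cg; apply: (measurability (@RGenOpens.G R)).
  exact: RGenOpens.measurableE.
move=> _ [_ [a [b ->] <-]]; rewrite setTI.
by apply: borel_open; move/continuousP: cg; apply; exact: interval_open.
Qed.

Lemma Rintegral_concentrated {R : realType} {S : topologicalType} (s0 s : S)
    (mu : {measure set (borel s0) -> \bar R}) (g : S -> R) :
  borel_set [set s] -> continuous g -> mu (~` [set s]) = 0%E ->
  Rintegral mu setT g = fine ((g s)%:E * mu setT)%E.
Proof.
move=> bs cg mus; rewrite /Rintegral -integral_cst//; congr fine.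
apply: ae_eq_integral => //.
- by apply/measurable_EFinP; exact: continuous_borel_measurable.
- exists (~` [set s]); split => //; first exact: measurableC.
  by move=> t /= nt ts; apply: nt => _; rewrite ts.
Qed.

(** * Continuity of complex-valued functions *)

Section ComplexContinuity.
Context {R : realType} {S : topologicalType}.
Implicit Types f g : S -> R[i]^o.

Lemma continuous_complexP f : continuous f <->
  forall s (e : R), 0 < e -> \forall t \near s, `|f s - f t| < e%:C.
Proof.
split=> [cf s e e0|cf s].
  by have /cvgrPdist_lt/(_ e%:C) := cf s; rewrite ltcR => /(_ e0).
apply/cvgrPdist_lt => e e0.
have -> : e = (complex.Re e)%:C by rewrite RRe_real// ger0_real// ltW.
by apply: cf; move: e0; rewrite ltcE => /andP[].
Qed.

Lemma Re_continuous f : continuous f -> continuous (fun s => complex.Re (f s) : R).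
Proof.
move=> /continuous_complexP cf s; apply/cvgrPdist_lt => e /(cf s).
apply: filterS => t /=; rewrite -ltcR; apply: le_lt_trans.
by rewrite -raddfB; exact: normc_ge_Re.
Qed.

Lemma conj_continuous f :
  continuous f -> continuous (fun s => Num.conj (f s) : R[i]^o).
Proof.
move=> /continuous_complexP cf; apply/continuous_complexP => s e /(cf s).
by apply: filterS => t; rewrite -rmorphB norm_conjC.
Qed.

Lemma normsq_continuous f : continuous f ->
  continuous (fun s => Num.conj (f s) * f s : R[i]^o).
Proof.
move=> cf s.
by apply: cvgM; [exact: conj_continuous | exact: cf].
Qed.

End ComplexContinuity.

(** * Compact operators *)

Section CompactOperator.
Context {R : realType} {H : completeNormedModType R[i]}.
Variable dot : {dot H for (@Num.conj R[i])}.
Hypothesis dotN : hilbert_dot dot.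
Variable T : {linear H -> H}.
Hypotheses (Tc : compact_operator T) (Tsa : self_adjoint dot T).
Implicit Types (x y v : H) (f u : nat -> H).

(** Sequential form of compactness: instead of extracting a subsequence, a point is found to which
    [T (u n)] comes arbitrarily close at arbitrarily late indices. *)
Lemma compact_operator_cluster u (M : R) : (forall n, nm (u n) <= M) ->
  exists y, forall e : R, 0 < e -> forall N, exists2 n, (N <= n)%N &
    nm (y - T (u n)) < e.
Proof.
(* Dividing by [M + 1], which is positive even for [M = 0], moves the sequence into the unit
   ball. *)
move=> uM; pose M1 := M + 1.
have M1_gt0 : 0 < M1 by rewrite ltr_wpDl// (le_trans (nm_ge0 _) (uM 0%N)).
move: Tc; rewrite /compact_operator precompactE.
move=> /(_ ((fun n => T (M1^-1%:C *: u n)) @ \oo)).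
case.
  exists 0%N => // n _ /=; apply: subset_closure; exists (M1^-1%:C *: u n) => //=.
  rewrite nmE nmZr lecR ger0_norm ?invr_ge0 ?(ltW M1_gt0)//.
  rewrite mulrC ler_pdivrMr// mul1r.
  by rewrite (le_trans (uM n))// lerDl.
move=> y [_ yc]; exists (M1%:C *: y) => e e0 N.
have e1 : 0 < (e / M1)%:C :> R[i] by rewrite ltcR divr_gt0.
have := yc [set T (M1^-1%:C *: u n) | n in [set n | (N <= n)%N]]
  (ball y (e / M1)%:C).
case.
- by exists N => // n Nn; exists n.
- exact: nbhsx_ballx.
move=> _ [[n Nn <-]]; rewrite -ball_normE/= nmE ltcR => yn; exists n => //.
have -> : M1%:C *: y - T (u n) = M1%:C *: (y - T (M1^-1%:C *: u n)).
  rewrite linearZ_LR scalerBr scalerA -rmorphM/= mulfV ?gt_eqF//.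
  by rewrite scale1r.
by rewrite nmZr gtr0_norm// mulrC -ltr_pdivlMr.
Qed.

Lemma compact_operator_bounded :
  exists2 C : R, 0 < C & forall x, nm (T x) <= C * nm x.
Proof.
apply: contrapT => nC.
have /choice[u uP] (n : nat) : exists x, nm x <= 1 /\ n%:R < nm (T x).
  apply: contrapT => nx; apply: nC; exists (n%:R + 1) => [|x].
    by rewrite ltr_wpDl.
  have [->|x0] := eqVneq x 0; first by rewrite linear0 nm0 mulr0.
  rewrite leNgt; apply/negP => lt; apply: nx.
  exists ((nm x)^-1%:C *: x); rewrite linearZ/= !nmZr.
  rewrite ger0_norm ?invr_ge0 ?nm_ge0// mulVf ?gt_eqF ?nm_gt0//; split=> //.
  rewrite mulrC ltr_pdivlMr ?nm_gt0//; apply: le_lt_trans lt.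
  by rewrite ler_wpM2r ?nm_ge0// lerDl.
have [y yP] := compact_operator_cluster (fun n => (uP n).1).
(* At such an index [n >= nm y + 1], while [nm (T (u n))] exceeds [n] and [T (u n)] is within 1 of
   [y]. *)
have [n] := yP 1 ltr01 (Num.truncn (nm y + 1)).+1.
rewrite ltNge => Nn /negP; apply.
have := (uP n).2; have := nm_lerB (T (u n)) y; rewrite nmBC.
have : nm y + 1 <= n%:R.
  by rewrite (le_trans (ltW (truncnS_gt _)))// ler_nat.
lra.
Qed.

(** The images [T (f n)] are pairwise orthogonal of length [c n], so any two of them are at distance
    at least [t] and they cannot cluster. *)
Lemma orthonormal_eigenseq_false f (c : nat -> R) (t : R) : 0 < t ->
  (forall n, nm (f n) = 1) ->
  (forall m n, (m < n)%N -> dot (f m) (f n) = 0) ->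
  (forall n, T (T (f n)) = (c n ^+ 2)%:C *: f n) ->
  (forall n, t <= c n) -> False.
Proof.
move=> t0 f1 f_orth Tf ct.
have f_le1 n : nm (f n) <= 1 by rewrite f1.
have [y yP] := compact_operator_cluster f_le1.
have t2 : 0 < t / 2 by rewrite divr_gt0.
have [m _ ym] := yP _ t2 0%N; have [n mn yn] := yP _ t2 m.+1.
have : nm (T (f m) - T (f n)) < t.
  rewrite (le_lt_trans (nm_tri y _ _))// [X in _ < X](splitr t).
  by rewrite ltrD// nmBC.
apply/negP; rewrite -leNgt -(@ler_pXn2r _ 2)// ?nnegrE ?nm_ge0 ?(ltW t0)//.
rewrite (nm_pythagorasB dotN); last first.
  by rewrite -Tsa Tf (dotZl dot) f_orth ?mulr0.
rewrite ler_wpDr ?sqr_ge0//.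
have -> : nm (T (f m)) ^+ 2 = c m ^+ 2.
  apply: complexI; rewrite -(dotxx dotN) -Tsa Tf (dotZl dot) (dotxx dotN) f1.
  by rewrite expr1n mulr1.
by rewrite ler_pXn2r ?nnegrE ?(ltW t0) ?(le_trans (ltW t0)).
Qed.

End CompactOperator.

(** * Completeness of eigenvectors and finite orthonormal bases *)

Section EigenvectorsComplete.
Context {R : realType} {H : completeNormedModType R[i]}.
Variable dot : {dot H for (@Num.conj R[i])}.
Hypothesis dotN : hilbert_dot dot.
Variable T : {linear H -> H}.
Hypotheses (Tc : compact_operator T) (Tsa : self_adjoint dot T).
Implicit Types (x y v : H) (f u : nat -> H).

(** This subspace is invariant under [T] by self-adjointness. If it were nonzero, it would contain
    an eigenvector of [T], orthogonal to itself. *)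
Let M : set H := [set x | forall (l : R[i]) v, T v = l *: v -> dot x v = 0].

Let M_T x : M x -> M (T x).
Proof.
by move=> Mx l v Tv; rewrite Tsa Tv dotZr (Mx l)// mulr0.
Qed.

Let MZ (c : R[i]) x : M x -> M (c *: x).
Proof. by move=> Mx l v /Mx; rewrite dotZl => ->; rewrite mulr0. Qed.

(** Here [N] is the norm of [T] restricted to [M]. Expanding the square bounds
    [nm (T (T y) - N^2 y) ^+ 2] by [N^4 - N^2 * nm (T y) ^+ 2], which is small when [y] nearly
    attains the norm. *)
Let M_approx_eigen x : M x -> T x != 0 -> exists2 N : R, 0 < N &
  forall e : R, 0 < e -> exists y, [/\ M y, nm y <= 1, N / 2 <= nm (T y) &
    nm (T (T y) - (N ^+ 2)%:C *: y) <= e].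
Proof.
move=> Mx Tx0.
have x0 : x != 0 by apply: contraNneq Tx0 => ->; rewrite linear0.
have [C C0 TC] := compact_operator_bounded Tc.
pose E := [set nm (T y) | y in [set y | M y /\ nm y <= 1]].
have Ex : E (nm (T ((nm x)^-1%:C *: x))).
  by exists ((nm x)^-1%:C *: x) => //; split; [exact: MZ|rewrite nm_normalized].
have hE : has_sup E.
  split; first by eexists; exact: Ex.
  exists C => _ [y [_ y1] <-]; rewrite (le_trans (TC _))//.
  by rewrite -[leRHS]mulr1 ler_wpM2l// ltW.
pose N := sup E.
have N_ub y : M y -> nm (T y) <= N * nm y.
  move=> My; have [->|y0] := eqVneq y 0; first by rewrite linear0 nm0 mulr0.
  have : nm (T ((nm y)^-1%:C *: y)) <= N.
    apply: (ub_le_sup hE.2); exists ((nm y)^-1%:C *: y) => //.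
    by split; [exact: MZ|rewrite nm_normalized].
  rewrite linearZ_LR nmZr ger0_norm ?invr_ge0 ?nm_ge0// mulrC.
  by rewrite ler_pdivrMr// nm_gt0.
have N0 : 0 < N.
  apply: lt_le_trans (ub_le_sup hE.2 Ex); rewrite linearZ_LR nmZr.
  by rewrite mulr_gt0// ?nm_gt0// normr_gt0 invr_neq0// gt_eqF// nm_gt0.
exists N => // e e0.
(* The first bound secures [N / 2 <= nm (T y)]. The second makes [N^2 * d * (2 * N)] at most
   [e ^+ 2], after factoring [N^2 - nm (T y)^2] and bounding [N + nm (T y)] by [2 * N]. *)
pose d := Num.min (N / 2) (e ^+ 2 / (2 * N ^+ 3)).
have d0 : 0 < d by rewrite lt_min !divr_gt0// ?exprn_gt0// mulr_gt0 ?exprn_gt0.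
have dN : d <= N / 2 by rewrite ge_min lexx.
have de : d <= e ^+ 2 / (2 * N ^+ 3) by rewrite ge_min lexx orbT.
have [_ [y [My y1] <-]] := sup_adherent d0 hE; rewrite -/N => Ny.
exists y; split=> //; first by clearbody d N; move: dN Ny; lra.
rewrite -(@ler_pXn2r _ 2)// ?nnegrE ?nm_ge0 ?(ltW e0)//.
set w := T (T y) - _.
have -> : nm w ^+ 2 =
    nm (T (T y)) ^+ 2 - 2 * N ^+ 2 * nm (T y) ^+ 2 + N ^+ 4 * nm y ^+ 2.
  apply: complexI; rewrite -(dotxx dotN) /w dotBl !dotBr !dotZl !dotZ_real.
  rewrite -[dot y (T _)]Tsa [dot (T (T y)) y]Tsa !(dotxx dotN).
  by rewrite rmorphD rmorphB/= !rmorphM/= rmorph_nat; ring.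
have y2 : nm y ^+ 2 <= 1 by rewrite expr_le1// nm_ge0.
have TTy : nm (T (T y)) ^+ 2 <= N ^+ 2 * nm (T y) ^+ 2.
  rewrite -exprMn ler_pXn2r ?nnegrE ?nm_ge0 ?mulr_ge0 ?nm_ge0 ?(ltW N0)//.
  by apply: N_ub; exact: M_T.
have Ty : N - nm (T y) <= e ^+ 2 / (2 * N ^+ 3).
  by clearbody d N; move: de Ny; set a := e ^+ 2 / _; lra.
have TyN : nm (T y) <= N by apply: (ub_le_sup hE.2); exists y.
have N4 : N ^+ 4 * nm y ^+ 2 <= N ^+ 4.
  by rewrite -[leRHS]mulr1 ler_wpM2l// exprn_ge0// ltW.
rewrite (@le_trans _ _ (N ^+ 2 * ((N - nm (T y)) * (2 * N))))//.
  have sq : N ^+ 2 * nm (T y) ^+ 2 >= 0 by rewrite mulr_ge0// sqr_ge0.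
  have : N ^+ 2 * ((N - nm (T y)) * (2 * N)) - (N ^+ 4 - N ^+ 2 * nm (T y) ^+ 2) =
    N ^+ 2 * (N - nm (T y)) ^+ 2 by ring.
  have : 0 <= N ^+ 2 * (N - nm (T y)) ^+ 2 by rewrite mulr_ge0// sqr_ge0.
  by move: TTy N4; lra.
have -> : e ^+ 2 = N ^+ 2 * (e ^+ 2 / (2 * N ^+ 3) * (2 * N)).
  by field; rewrite gt_eqF.
by rewrite ler_wpM2l ?sqr_ge0// ler_wpM2r// mulr_ge0// ltW.
Qed.

(** Approximate maximizers [u n] in [M] have images clustering at some nonzero [y] in [M] with
    [T (T y) = N^2 y]. Factoring [T^2 - N^2] then yields an eigenvector inside [M]. *)
Lemma eigenvectors_complete x : injective T ->
  (forall (l : R[i]) v, T v = l *: v -> dot x v = 0) -> x = 0.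
Proof.
move=> Tinj Mx; apply/eqP/negPn/negP => x0.
have Tx0 : T x != 0.
  by apply: contra x0 => /eqP Tx0; apply/eqP/Tinj; rewrite Tx0 linear0.
have [N N0 approx] := M_approx_eigen Mx Tx0.
have [C C0 TC] := compact_operator_bounded Tc.
have /choice[u uP] (n : nat) : exists y, [/\ M y, nm y <= 1,
    N / 2 <= nm (T y) & nm (T (T y) - (N ^+ 2)%:C *: y) <= n.+1%:R^-1].
  by apply: approx; rewrite invr_gt0.
have u1 n : nm (u n) <= 1 by case: (uP n).
have [y yP] := compact_operator_cluster Tc u1.
have My : M y.
  move=> l v Tv; apply: (dot_approx0 dotN) => e e0.
  have [n _ yn] := yP e e0 0%N; exists (T (u n)); split; first exact: ltW.
  case: (uP n) => Mun _ _ _.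
  by rewrite (M_T Mun Tv)// normr0 ler0c ltW.
have y0 : y != 0.
  apply/eqP => y0; have [|n _] := yP (N / 2) _ 0%N; first exact: divr_gt0.
  by rewrite y0 sub0r nmN ltNge; case: (uP n) => _ _ -> _.
have TTy : T (T y) = (N ^+ 2)%:C *: y.
  apply/eqP; rewrite -subr_eq0; apply/eqP/(dot_eq0 dotN) => v.
  rewrite dotBl !Tsa dotZl -dotZ_real -dotBr.
  apply: (dot_approx0 dotN) => e e0.
  (* The residual of [u n] is stretched by [T] by at most [C] and then paired with [v]. *)
  pose e1 := e / (C * (nm v + 1)).
  have v1 : 0 < nm v + 1 by rewrite ltr_wpDl// nm_ge0.
  have e10 : 0 < e1 by rewrite divr_gt0// mulr_gt0.
  have [n nN yn] := yP e e0 (Num.truncn e1^-1); exists (T (u n)).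
  split; first exact: ltW.
  rewrite dotBr -!Tsa dotZ_real -dotZl -dotBl -linearZ_LR -linearB.
  rewrite (le_trans (cauchy_schwarz dotN _ _))// lecR.
  case: (uP n) => _ _ _ un.
  have un1 : nm (T (T (u n)) - (N ^+ 2)%:C *: u n) <= e1.
    rewrite (le_trans un)// invf_ple ?posrE// (le_trans (ltW (truncnS_gt _)))//.
    by rewrite ler_nat.
  have -> : e = C * e1 * (nm v + 1) by rewrite /e1; field; rewrite !gt_eqF.
  rewrite ler_pM ?nm_ge0// ?lerDl//.
  by rewrite (le_trans (TC _))// ler_wpM2l// ltW.
(* [w] is an eigenvector for [N] orthogonal to both of its own summands, hence zero. So [y] itself
   is an eigenvector for [-N]. *)
pose w := T y + N%:C *: y.
have Tw : T w = N%:C *: w.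
  rewrite /w linearD TTy linearZ_LR scalerDr scalerA -rmorphM/= -expr2.
  by rewrite addrC.
have w0 : w = 0.
  apply: nm_eq0; apply/eqP; rewrite -sqrf_eq0; apply/eqP/complexI.
  rewrite -(dotxx dotN) {1}/w dotDl dotZl (My _ _ Tw) mulr0 addr0.
  by rewrite (M_T My Tw).
have Ty : T y = (- N%:C) *: y.
  by apply/eqP; rewrite scaleNr -addr_eq0; apply/eqP.
by move: y0; rewrite -(dnorm_eq0 dot) (My _ _ Ty) eqxx.
Qed.

End EigenvectorsComplete.

Section FiniteOrthonormalBasis.
Context {R : realType} {H : completeNormedModType R[i]}.
Variable dot : {dot H for (@Num.conj R[i])}.
Hypothesis dotN : hilbert_dot dot.

(** Completeness is expressed by maximality: no nonzero vector of [V] is orthogonal to the first [m]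
    vectors. *)
Definition orthonormal_basis (V : set H) (m : nat) (e : nat -> H) : Prop :=
  [/\ forall k, (k < m)%N -> V (e k) /\ nm (e k) = 1,
      forall j k, (j < m)%N -> (k < m)%N -> j != k -> dot (e j) (e k) = 0 &
      forall x, V x -> (forall k, (k < m)%N -> dot x (e k) = 0) -> x = 0].

(** If no finite orthonormal list in [V] were maximal, each could be extended, and iterating the
    extension would give an infinite orthonormal sequence. *)
Lemma finite_orthonormal_basis (V : set H) :
  (forall (c : R) x, V x -> V (c%:C *: x)) ->
  (forall f : nat -> H, (forall n, V (f n) /\ nm (f n) = 1) ->
    (forall m n, (m < n)%N -> dot (f m) (f n) = 0) -> False) ->
  exists (m : nat) (e : nat -> H), orthonormal_basis V m e.
Proof.
move=> VZ V_fin; apply: contrapT => nbasis.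
pose good (s : seq H) := pairwise (fun x y => dot x y == 0) s &&
  all (fun x => `[< V x >] && (nm x == 1)) s.
have /choice[ext extP] (s : seq H) : exists x, good s -> good (x :: s).
  have [gs|] := boolP (good s); last by exists 0.
  have [x Px] : exists x, [/\ V x, nm x = 1 & forall y, y \in s -> dot x y = 0].
    apply: contrapT => nx; apply: nbasis; exists (size s), (nth 0 s).
    have /andP[/(pairwiseP 0) pw /allP sV] := gs; split.
    - by move=> k ks; have /andP[/asboolP ? /eqP] := sV _ (mem_nth 0 ks).
    - move=> j k js ks; rewrite neq_ltn => /orP[jk|kj].
        exact/eqP/pw.
      by apply: dot_eq0C; exact/eqP/pw.
    - move=> x Vx xs; apply/eqP/negPn/negP => x0; apply: nx.
      exists ((nm x)^-1%:C *: x); split; first exact: VZ.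
        exact: nm_normalized.
      by move=> y /(nthP 0)[k ks <-]; rewrite dotZl xs// mulr0.
  exists x => _; case: Px => Vx x1 xs; rewrite /good /= x1 eqxx andbT.
  have /andP[-> ->] := gs; rewrite !andbT; apply/andP; split; last exact/asboolP.
  by apply/allP => y /xs ->.
pose s n := iter n (fun s => ext s :: s) [::].
have gs n : good (s n) by elim: n => // n IH; exact: extP.
apply: (V_fin (fun n => ext (s n))) => [n|m n mn].
  by have /andP[_ /= /andP[/andP[/asboolP ? /eqP]]] := gs n.+1.
have /andP[/= /andP[/allP nm_orth _] _] := gs n.+1.
apply: dot_eq0C; apply/eqP/nm_orth.
elim: n mn {nm_orth} => // n IH; rewrite ltnS leq_eqVlt => /orP[/eqP ->|mn].
  by rewrite /= mem_head.
by rewrite /= in_cons IH// orbT.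
Qed.

End FiniteOrthonormalBasis.

(** * Orthogonal series *)

Section OrthogonalSeries.
Context {R : realType} {H : completeNormedModType R[i]}.
Variable dot : {dot H for (@Num.conj R[i])}.
Hypothesis dotN : hilbert_dot dot.

Lemma cauchy_seq_cvg (u : nat -> H) :
  (forall e : R, 0 < e -> exists N, forall m n, (N <= m)%N -> (N <= n)%N ->
    nm (u m - u n) < e) ->
  exists y, forall e : R, 0 < e -> exists N, forall n, (N <= n)%N ->
    nm (y - u n) < e.
Proof.
move=> uC; have : cauchy_ex (u @ \oo).
  move=> e e0; have eE : e = (complex.Re e)%:C by rewrite RRe_real// ger0_real// ltW.
  have /uC[N uN] : 0 < complex.Re e by rewrite -ltcR -eE.
  exists (u N); exists N => // n /= Nn.
  by rewrite -ball_normE/= nmE eE ltcR uN.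
move/cauchy_exP/cauchy_cvg => /cvg_ex[y uy]; exists y => e e0.
have /cvgrPdist_lt/(_ e%:C) := uy; rewrite ltcR => /(_ e0)[N _ uN].
by exists N => n /uN/=; rewrite nmE ltcR.
Qed.

Lemma dot_suml (I : Type) (r : seq I) (Q : pred I) (F : I -> H) y :
  dot (\sum_(i <- r | Q i) F i) y = \sum_(i <- r | Q i) dot (F i) y.
Proof.
apply: (big_morph (dot^~ y)) => [a b|]; [exact: dotDl|exact: dot0l].
Qed.

Lemma dot_sumr (I : Type) (r : seq I) (Q : pred I) (F : I -> H) y :
  dot y (\sum_(i <- r | Q i) F i) = \sum_(i <- r | Q i) dot y (F i).
Proof.
apply: (big_morph (dot y)) => [a b|]; [exact: dotDr|exact: dot0r].
Qed.

Variables (I : choiceType) (D : set I) (g : I -> H).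
Hypothesis g_orth : forall i j, D i -> D j -> i <> j -> dot (g i) (g j) = 0.

Let S (A : set I) := \sum_(i \in A) g i.
Let q (A : set I) : R := \sum_(i \in A) nm (g i) ^+ 2.

Let dot_S A v : finite_set A -> dot (S A) v = \sum_(i \in A) dot (g i) v.
Proof. by move=> fA; rewrite /S !fsbig_finite//= dot_suml. Qed.

Let nm_S A : finite_set A -> A `<=` D -> nm (S A) ^+ 2 = q A.
Proof.
move=> fA AD; rewrite /S /q !fsbig_finite//=.
have : {subset finmap.enum_fset (fset_set A) <= [pred i | `[< D i >]]}.
  by move=> i; rewrite [_ \in _]in_fset_set// inE => /AD Di; apply/asboolP.
elim: (finmap.enum_fset _) (finmap.fset_uniq (fset_set A)) => /= [|i r IH].
  by rewrite !big_nil nm0 expr0n.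
move=> /andP[ir ur] sub; rewrite !big_cons (nm_pythagoras dotN) ?IH//.
  by move=> j jr; apply: sub; rewrite in_cons jr orbT.
rewrite dot_sumr big_seq big1// => j jr; apply: g_orth.
- by apply/asboolP/sub; rewrite mem_head.
- by apply/asboolP/sub; rewrite in_cons jr orbT.
- by move=> ij; move: ir; rewrite ij jr.
Qed.

Let nm_SB A B : finite_set B -> B `<=` D -> A `<=` B ->
  nm (S B - S A) ^+ 2 = q B - q A.
Proof.
move=> fB BD AB; have fBA : finite_set (B `&` ~` A) by exact: finite_setIl.
have AI : B `&` A = A by rewrite setIidr.
rewrite /S /q !(fsbigID A B)//= AI !(addrC (\sum_(i \in A) _)) !addrK.
by apply: nm_S => // i [/BD].
Qed.

(** The hypothesis gives [dot (S A) y = nm (S A) ^+ 2] for finite [A], and Cauchy-Schwarz then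
    yields [nm (S A) <= nm y]. *)
Lemma bessel y : (forall i, D i -> dot y (g i) = dot (g i) (g i)) ->
  (\esum_(i in D) (nm (g i) ^+ 2)%:E <= (nm y ^+ 2)%:E)%E.
Proof.
move=> yg; apply: ub_ereal_sup => _ [A [fA AD] <-].
rewrite fsumEFin// lee_fin -[leLHS]/(q A) -nm_S//.
have e : dot (S A) y = (nm (S A) ^+ 2)%:C.
  rewrite nm_S// dot_S// /q !fsbig_finite//= rmorph_sum/= !big_seq.
  apply: eq_bigr => i; rewrite in_fset_set// inE => /AD Di.
  by rewrite dotC yg// -dotC (dotxx dotN).
have := cauchy_schwarz dotN (S A) y; rewrite e.
rewrite ger0_norm ?ler0c ?sqr_ge0// lecR expr2.
have [-> _|SA0] := eqVneq (S A) 0; first by rewrite nm0 mulr0 sqr_ge0.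
by rewrite ler_pM2l ?nm_gt0// => le; rewrite -expr2 ler_pXn2r ?nnegrE ?nm_ge0.
Qed.

(** The sum is a limit over finite sets [F n] that nearly exhaust the total mass. The second clause
    recovers a coefficient by testing against a [v] that sees a single term. *)
Lemma orthogonal_series :
  (\esum_(i in D) (nm (g i) ^+ 2)%:E < +oo)%E -> exists y,
    (nm y ^+ 2)%:E = \esum_(i in D) (nm (g i) ^+ 2)%:E /\
    forall i v, D i -> (forall j, D j -> j <> i -> dot (g j) v = 0) ->
      dot y v = dot (g i) v.
Proof.
set E := (\esum_(i in D) _) => Eoo.
have E0 : (0 <= E)%E by apply: esum_ge0 => i _; rewrite lee_fin sqr_ge0.
have Efin : E \is a fin_num by rewrite ge0_fin_numE.
pose M := fine E; have EM : E = M%:E by rewrite fineK.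
have q_le A : finite_set A -> A `<=` D -> q A <= M.
  move=> fA AD; rewrite -lee_fin -EM /q -fsumEFin//.
  by apply: ereal_sup_ubound; exists A.
(* The tolerance is squared because masses are squared norms: enlarging [F n] moves the partial sum
   by at most [n.+1%:R^-1]. *)
have near_sup (n : nat) : exists A, [/\ finite_set A, A `<=` D &
    M - (n.+1%:R^-1) ^+ 2 < q A].
  have := @ub_ereal_sup_adherent _ _ _ (exprn_gt0 2 (_ : 0 < n.+1%:R^-1)) Efin.
  rewrite invr_gt0 ltr0n => /(_ isT)[_ [A [fA AD] <-]].
  rewrite -/(esum _ _) -/E EM fsumEFin// -EFinB lte_fin => lt.
  by exists A.
have /choice[F FP] := near_sup.
have SF n B : finite_set B -> B `<=` D -> F n `<=` B ->
    nm (S B - S (F n)) <= n.+1%:R^-1.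
  move=> fB BD FB; have n0 : 0 <= n.+1%:R^-1 :> R by rewrite invr_ge0.
  rewrite -(@ler_pXn2r _ 2)// ?nnegrE ?nm_ge0// nm_SB//.
  have [_ _ ] := FP n; have := q_le _ fB BD; set a := _ ^+ 2; lra.
have small (e : R) : 0 < e -> exists N, forall n, (N <= n)%N -> n.+1%:R^-1 <= e.
  move=> e0; exists (Num.truncn e^-1) => n Nn.
  rewrite invf_ple ?posrE// (le_trans (ltW (truncnS_gt _)))//.
  by rewrite ler_nat.
have [y yP] : exists y, forall e : R, 0 < e -> exists N, forall n, (N <= n)%N ->
    nm (y - S (F n)) < e.
  apply: cauchy_seq_cvg => e e0.
  have [|N NP] := small (e / 3); first exact: divr_gt0.
  exists N => m n Nm Nn.
  have [[fm Fm _] [fn Fn _]] := (FP m, FP n).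
  have fU : finite_set (F m `|` F n) by rewrite finite_setU.
  have UD : F m `|` F n `<=` D by rewrite subUset.
  have := nm_tri (S (F m `|` F n)) (S (F m)) (S (F n)).
  rewrite (nmBC (S (F m)) (S (_ `|` _))).
  have := SF n _ fU UD (@subsetUr _ _ _); have := SF m _ fU UD (@subsetUl _ _ _).
  have := NP m Nm; have := NP n Nn; move: e0.
  by move: (m.+1%:R^-1) (n.+1%:R^-1) => a b; lra.
have approx (e : R) : 0 < e -> exists A, [/\ finite_set A, A `<=` D &
    forall B, finite_set B -> B `<=` D -> A `<=` B -> nm (y - S B) <= e].
  move=> e0; have e2 : 0 < e / 2 by rewrite divr_gt0.
  have [N1 N1P] := yP _ e2; have [N2 N2P] := small _ e2.
  pose n := maxn N1 N2; have [fn Fn _] := FP n; exists (F n); split=> // B fB BD FB.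
  have := nm_tri (S (F n)) y (S B); rewrite (nmBC (S (F n)) (S B)).
  have := SF n _ fB BD FB; have := N1P n (leq_maxl _ _).
  have := N2P n (leq_maxr _ _).
  by move: (n.+1%:R^-1) => a; lra.
have y_dot i v : D i -> (forall j, D j -> j <> i -> dot (g j) v = 0) ->
    dot y v = dot (g i) v.
  move=> Di vP; apply/eqP; rewrite -subr_eq0 -dotBl; apply/eqP.
  apply: (dot_approx0 dotN) => e e0; have [A [fA AD Ae]] := approx e e0.
  (* Once [i] is added to the approximating set, [g i] is the only term of the partial sum that [v]
     sees. *)
  have fB : finite_set (A `|` [set i]) by rewrite finite_setU.
  have BD : A `|` [set i] `<=` D by rewrite subUset; split=> // j ->.
  exists (S (A `|` [set i]) - g i); split.
    by rewrite opprB addrA subrK Ae.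
  rewrite dotBl dot_S// (fsbigID [set i])//=.
  rewrite (_ : (A `|` [set i]) `&` [set i] = [set i]); last first.
    by rewrite setIidr//; exact: subsetUr.
  rewrite fsbig_set1 fsbig1 ?addr0 ?subrr ?normr0 ?ler0c ?(ltW e0)// => j [/BD].
  by move=> Dj ji; rewrite vP.
(* Bessel gives the lower bound on the norm of [y], the finite partial sums the upper one. *)
exists y; split=> //; apply/eqP; rewrite eq_le -/E; apply/andP; split; last first.
  apply: bessel => i Di; apply: y_dot => // j Dj ji.
  by rewrite g_orth.
rewrite EM lee_fin.
have M0 : 0 <= M by rewrite -lee_fin -EM.
rewrite -[leRHS]sqr_sqrtr// ler_pXn2r ?nnegrE ?nm_ge0 ?sqrtr_ge0//.
apply/ler_addgt0Pl => e e0; have [A [fA AD Ae]] := approx e e0.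
rewrite -[y](subrK (S A)) (le_trans (nmD _ _))// lerD ?Ae//.
by rewrite -(@ler_pXn2r _ 2)// ?nnegrE ?nm_ge0 ?sqrtr_ge0// sqr_sqrtr// nm_S// q_le.
Qed.

End OrthogonalSeries.

(** * Atoms of a spectral geometry *)

(** A countable family of open, hence Borel, sets lets [P] at a point be reached by countable
    additivity on complements. *)
Lemma set1_eq_bigcap_ball {R : realType} {X : metricType R} (z : X * X) :
  [set z] = \bigcap_n (ball z n.+1%:R^-1)^°.
Proof.
apply/seteqP; split=> [_ -> n _|w wz]; first by apply: nbhsx_ballx; rewrite invr_gt0.
have d0 (a b : X) : (forall n, mdist a b < n.+1%:R^-1) -> a = b.
  move=> ab; apply: mdist_positivity; apply/le_anti; rewrite mdist_ge0 andbT.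
  apply/ler_addgt0Pl => e e0; rewrite addr0.
  apply: (le_trans (ltW (ab (Num.truncn e^-1)))).
  by rewrite invf_ple ?posrE// ltW// truncnS_gt.
have bzw n : ball z n.+1%:R^-1 w by apply: interior_subset; exact: wz.
case: z w bzw {wz} => z1 z2 [w1 w2] bzw.
by congr pair; apply/esym/d0 => n; have [] := bzw n; rewrite /= !ballEmdist.
Qed.

Lemma closed_set1_prod {R : realType} {X : metricType R} (z : X * X) :
  closed [set z].
Proof.
have cX (x : X) : closed [set x].
  exact/accessible_closed_set1/hausdorff_accessible/metric_hausdorff.
have -> : [set z] = (fst @^-1` [set z.1]) `&` (snd @^-1` [set z.2]).
  by apply/seteqP; split => [_ ->//|[a b] [/= -> ->]]; case: z.
apply: closedI; apply: closed_comp => // w _; [exact: cvg_fst|exact: cvg_snd].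
Qed.

Lemma continuous_functions_cst {R : realType} {S : topologicalType} (c : R[i]) :
  continuous_functions (fun _ : S => c).
Proof. by move=> s; apply: (@cvg_cst R[i]^o). Qed.

Section SpectralGeometry.
Context {R : realType} {X : metricType R} {H : completeNormedModType R[i]}.
Variable dot : {dot H for (@Num.conj R[i])}.
Hypothesis dotN : hilbert_dot dot.
Variable G : spectral_geometry X dot.
Variable z0 : X * X.
Local Notation T := (sg_ds G).
Local Notation P := (sg_P G).
Local Notation L := (sq_eigenspace T).
Local Notation A := (A_set dot T P).
Local Notation Lam := (Lambda_set dot T P).
Local Notation B := (sg_support G).
Let Psm := sg_P_spectral G.
Let Tsa := sg_ds_self_adjoint G.
Let Tinj := @sg_ds_injective _ _ _ _ G.

(** The total mass of the scalar measure of [x] is the integral of 1, that is [dot x x], since the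
    representation is unital. *)
Lemma spectral_setT x : P setT x = x.
Proof.
have bT : borel_set [set: X * X] by apply: borel_open; exact: openT.
apply: (proj_fix dotN (sm_projector Psm bT)).
have [mu [muP muE]] := scalar_measureE dotN z0 Psm x.
have c1 : continuous_functions (fun _ : X * X => 1 : R[i]).
  exact: continuous_functions_cst.
have := sg_pi_tilde_integral c1 muP.
rewrite (rep_one (sg_pi_tilde_rep G)) (dotxx dotN) => -[->].
rewrite /Rintegral (_ : (\int[mu]_w (1 : R)%:E)%E = mu setT).
  by rewrite muE.
by rewrite integral_cst// mul1e.
Qed.

Lemma eigen_neq0 l : op_eigenvalue T l -> l != 0.
Proof.
move=> [x [x0 Tx]]; apply: contra x0 => /eqP l0; apply/eqP/Tinj.
by rewrite Tx l0 scale0r linear0.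
Qed.

Lemma eigen_real l : op_eigenvalue T l -> l \is Num.real.
Proof.
move=> [x [x0 Tx]]; apply/CrealP; apply/esym.
have xx0 : dot x x != 0 by rewrite (dnorm_eq0 dot).
by apply: (mulIf xx0); have := Tsa x x; rewrite Tx dotZl dotZr.
Qed.

Lemma open_A_set l : open (A l).
Proof. by apply: bigcup_open => C []. Qed.

Let borel_A l : borel_set (A l).
Proof. by apply: borel_open; exact: open_A_set. Qed.

Let borel_Lam l : borel_set (Lam l).
Proof. by apply: (borel_closed z0); rewrite closedC; exact: open_A_set. Qed.

Let borel1 (z : X * X) : borel_set [set z].
Proof. by apply: (borel_closed z0); exact: closed_set1_prod. Qed.

Lemma A_eigenspace0 l y : op_eigenvalue T l -> L l y -> P (A l) y = 0.
Proof.
move=> el Ly; have [pA rA] := sg_A_projector el.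
have : range (P (A l)) (P (A l) y) by exists y.
rewrite rA => /(_ _ Ly); rewrite (proj_dot dotN pA) => -[/eqP].
by rewrite sqrf_eq0 => /eqP/nm_eq0.
Qed.

(** Forward direction: for every [x], [T (T x) - l^2 x] is orthogonal to [L l], hence lies in the
    range of [P (A l)], which is orthogonal to [y]. Self-adjointness moves [T^2 - l^2] onto [y]. *)
Lemma Lambda_fixP l y : op_eigenvalue T l -> P (Lam l) y = y <-> L l y.
Proof.
move=> el; have [pA rA] := sg_A_projector el; split=> [Py|Ly]; last first.
  rewrite /Lambda_set (spectral_setC dotN z0 Psm _ spectral_setT)//.
  by rewrite A_eigenspace0// subr0.
have Ay0 : P (A l) y = 0.
  move: Py; rewrite /Lambda_set (spectral_setC dotN z0 Psm _ spectral_setT)//.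
  by rewrite -[RHS]subr0 => /addrI/oppr_inj.
have [c l2] : exists c : R, l ^+ 2 = c%:C.
  by apply/complex_realP; rewrite rpredX// eigen_real.
apply/eqP; rewrite -subr_eq0; apply/eqP/(dot_eq0 dotN) => x.
rewrite l2 dotBl !Tsa dotZl -dotZ_real -dotBr.
have : range (P (A l)) (T (T x) - c%:C *: x).
  by rewrite rA => v Lv; rewrite dotBl !Tsa Lv l2 dotZl dotZ_real subrr.
move=> -[w _ <-]; case: pA => _ <-.
by rewrite Ay0 dot0l.
Qed.

Lemma Lambda_atom l z : op_eigenvalue T l -> Lam l z ->
  exists2 y, y != 0 & P [set z] y = y.
Proof.
move=> el Lz; pose V n := (ball z n.+1%:R^-1)^°.
have Vz n : V n z by apply: nbhsx_ballx; rewrite invr_gt0.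
have oV n : open (V n) by exact: open_interior.
have bV n : borel_set (V n) by exact: borel_open.
have V_sub m n : (m <= n)%N -> V n `<=` V m.
  move=> mn; apply: interiorS; apply: (@le_ball _ (X * X)%type).
  by rewrite lef_pV2 ?posrE// ler_nat.
have /choice[u uP] (n : nat) : exists u, [/\ nm u = 1, L l u & P (V n) u = u].
  (* Otherwise [V n] would be one of the open sets whose union is [A l], contrary to [Lam l z]. *)
  have [y Ly Vy] : exists2 y, L l y & P (V n) y != 0.
    apply: contrapT => nV; apply: Lz; exists (V n) => //; split=> // _ [x _ <-] y Ly.
    have [_ ->] := sm_projector Psm (bV n).
    suff -> : P (V n) y = 0 by rewrite dot0r.
    by apply/eqP/negPn/negP => Vy; apply: nV; exists y.
  (* Cutting with [Lam l] keeps the vector in the range of [P (Lam l)], which is [L l]. *)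
  have bVL : borel_set (V n `&` Lam l) by exact: (borel_setI z0).
  pose w := P (V n `&` Lam l) y.
  have w0 : w != 0.
    apply: contra Vy => /eqP w0; apply/eqP.
    (* The two pieces of [V n] as a sequence, constant from rank 1 on. The first kills [y] by [w0],
       the other because [P (A l)] vanishes on [L l]. *)
    pose C (k : nat) := if k is 0%N then V n `&` Lam l else V n `&` A l.
    have -> : V n = \bigcup_k C k.
      apply/seteqP; split => [t Vt|t [[|k] _ []//]].
      by have [tA|tA] := pselect (A l t); [exists 1%N|exists 0%N].
    apply: (spectral_null_bigcup dotN z0 Psm) => -[|k] //=.
      exact: (borel_setI z0).
    apply: (spectral_null_sub dotN z0 Psm _ (borel_A l)).
      exact: (borel_setI z0).
      by move=> t [].
    exact: A_eigenspace0.
  exists ((nm w)^-1%:C *: w); split.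
  - exact: nm_normalized.
  - apply/Lambda_fixP => //; rewrite linearZ_LR; congr (_ *: _).
    by apply: (spectral_sub dotN z0 Psm) => // t [].
  - rewrite linearZ_LR; congr (_ *: _).
    by apply: (spectral_sub dotN z0 Psm) => // t [].
have [C C0 TC] := compact_operator_bounded (sg_ds_compact G).
(* Applying [T] once more to [T (u n)] gives [l ^+ 2 *: u n], so the cluster point is approached by
   vectors in the ranges of the [P (V n)]. *)
have Tu_le n : nm (T (u n)) <= C.
  by case: (uP n) => u1 _ _; rewrite (le_trans (TC _))// u1 mulr1.
have [y yP] := compact_operator_cluster (sg_ds_compact G) Tu_le.
have l2 : 0 < nm (l ^+ 2 : R[i]^o).
  by apply: nm_gt0; rewrite expf_neq0// eigen_neq0.
have Tu n : T (T (u n)) = l ^+ 2 *: u n by case: (uP n).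
exists y.
  apply/eqP => y0; have [n _] := yP _ l2 0%N.
  by rewrite y0 sub0r nmN Tu nmZ; case: (uP n) => -> _ _; rewrite mulr1 ltxx.
have Vy n : P (V n) y = y.
  apply: (proj_approx dotN (sm_projector Psm (bV n))) => e e0.
  have [m nm ym] := yP e e0 n; exists (T (T (u m))); split; first exact: ltW.
  rewrite Tu linearZ_LR; congr (_ *: _); have [_ _ <-] := uP m.
  by apply: (spectral_sub dotN z0 Psm) => //; exact: V_sub.
have zE : ~` [set z] = \bigcup_n ~` V n.
  by rewrite set1_eq_bigcap_ball setC_bigcap.
have PC0 : P (~` [set z]) y = 0.
  rewrite zE; apply: (spectral_null_bigcup dotN z0 Psm) => n.
    by apply: (borel_closed z0); rewrite closedC.
  by rewrite (spectral_setC dotN z0 Psm _ spectral_setT)// Vy subrr.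
move: PC0; rewrite (spectral_setC dotN z0 Psm _ spectral_setT)//.
by move/eqP; rewrite subr_eq0 => /eqP.
Qed.

Local Notation d z := (mdist z.1 z.2).

Lemma support_atom z : B z -> exists2 y, y != 0 & P [set z] y = y.
Proof. by move=> [l el Lz]; exact: Lambda_atom el Lz. Qed.

Lemma support_dist_gt0 z : B z -> 0 < d z.
Proof.
move=> [l el]; case: z => y y' /(sg_Lambda_dist el) e.
by rewrite -ltcR /= e normr_gt0 eigen_neq0.
Qed.

Lemma support_sq_eigen z y : B z -> P [set z] y = y ->
  T (T y) = (d z ^+ 2)%:C *: y.
Proof.
move=> [l el]; case: z => a b Lz Py.
have -> : (d (a, b) ^+ 2)%:C = l ^+ 2.
  by rewrite rmorphXn/= (sg_Lambda_dist el Lz) real_normK// eigen_real.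
apply/Lambda_fixP => //; apply: (spectral_fix_sub dotN z0 Psm _ _ _ Py) => //.
by move=> _ ->.
Qed.

Lemma ds_swap z y : P [set z] y = y -> P [set swap_pair z] (T y) = T y.
Proof. by move=> Py; rewrite -{2}Py (sg_ds_P G (borel1 z)) image_set1. Qed.

(** If the swapped point lay in [A l], then [T y], for [y] in the range at [z], would be fixed by
    [P (A l)]. But [T y] is in [L l], where [P (A l)] vanishes. *)
Lemma support_swap z : B z -> B (swap_pair z).
Proof.
move=> [l el Lz]; exists l => // Az.
have [y y0 Py] := Lambda_atom el Lz.
have Ly : L l y.
  apply/Lambda_fixP => //; apply: (spectral_fix_sub dotN z0 Psm _ _ _ Py) => //.
  by move=> _ ->.
have LTy : L l (T y) by rewrite /sq_eigenspace/= Ly linearZ_LR.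
have : P (A l) (T y) = T y.
  apply: (spectral_fix_sub dotN z0 Psm _ _ _ (ds_swap Py)) => //.
  by move=> _ ->.
rewrite A_eigenspace0// => /esym Ty0.
by move/eqP: y0; apply; apply: Tinj; rewrite Ty0 linear0.
Qed.

Lemma atoms_orthogonal z w x y : z <> w -> P [set z] x = x -> P [set w] y = y ->
  dot x y = 0.
Proof.
move=> zw Px Py; have [_ saw] := sm_projector Psm (borel1 w).
rewrite -Py -saw -Px (spectral_disjoint dotN z0 Psm)// ?dot0l//.
by apply/seteqP; split=> t // [-> /zw].
Qed.

Lemma finite_support_ge (t : R) : 0 < t -> finite_set [set z | B z /\ t <= d z].
Proof.
move=> t0; apply: contrapT => /infiniteP cle.
have /(@pcard_leP nat (borel z0))[f] := cle.
have fB n : B (f n) /\ t <= d (f n) by exact: (@funS _ _ setT _ f n Logic.I).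
have /choice[u uP] (n : nat) : exists u, nm u = 1 /\ P [set f n] u = u.
  have [y y0 Py] := support_atom (fB n).1; exists ((nm y)^-1%:C *: y); split.
    exact: nm_normalized.
  by rewrite linearZ_LR Py.
apply: (orthonormal_eigenseq_false dotN (sg_ds_compact G) Tsa t0
  (f := u) (c := fun n => d (f n))) => [n|m n mn|n|n].
- by case: (uP n).
- apply: atoms_orthogonal (uP m).2 (uP n).2 => fmn.
  have /(_ (in_setT _) (in_setT _) fmn) mn' := @inj _ _ _ f m n.
  by rewrite mn' ltnn in mn.
- exact: support_sq_eigen (fB n).1 (uP n).2.
- by case: (fB n).
Qed.

(** An eigenvector for [l] lies in the range of [P (Lam l)]. This projector kills [x] because
    [Lam l] is a finite set of support points. *)
Lemma support_complete x : (forall z, B z -> P [set z] x = 0) -> x = 0.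
Proof.
move=> x0; apply: (eigenvectors_complete dotN (sg_ds_compact G) Tsa Tinj).
move=> l v Tv; have [->|v0] := eqVneq v 0; first by rewrite dot0r.
have el : op_eigenvalue T l by exists v.
have Lv : L l v by rewrite /sq_eigenspace/= Tv linearZ_LR Tv scalerA expr2.
suff Px : P (Lam l) x = 0.
  have [_ saL] := sm_projector Psm (borel_Lam l).
  by move/(Lambda_fixP _ el): Lv => <-; rewrite -saL Px dot0l.
have fL : finite_set (Lam l).
  have l0 : 0 < nm (l : R[i]^o) by apply: nm_gt0; exact: eigen_neq0.
  apply: sub_finite_set (finite_support_ge l0) => -[a b] Lz.
  split; first by exists l.
  by rewrite -lecR -nmE (sg_Lambda_dist el Lz).
have LB z : Lam l z -> B z by move=> Lz; exists l.
(* For empty [Lam l], the set is disjoint from itself, so its projector squares to zero. Otherwise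
   the head [z] serves as default beyond the end of the list, so every [nth] is a member. *)
move/finite_seqP: fL => [[|z s] LamE].
  have P0 := spectral_disjoint dotN z0 Psm x (borel_Lam l) (borel_Lam l).
  have [pL _] := sm_projector Psm (borel_Lam l).
  by rewrite -pL P0// LamE; apply/seteqP; split=> t // [].
have -> : Lam l = \bigcup_n [set nth z (z :: s) n].
  rewrite LamE; apply/seteqP; split=> [t /(nthP z)[n _ <-]|t [n _ ->]].
    by exists n.
  have [ns|ns] := ltnP n (size (z :: s)); first by apply/mem_nth.
  by rewrite nth_default//= mem_head.
apply: (spectral_null_bigcup dotN z0 Psm) => n; first exact: borel1.
apply/x0/LB; rewrite LamE /=.
have [ns|ns] := ltnP n (size (z :: s)); first by apply/mem_nth.
by rewrite nth_default//= mem_head.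
Qed.

(** * The action of Lipschitz functions on atoms *)

Lemma lipschitz_continuous (a : X -> R[i]) : lipschitz_functions a ->
  continuous_functions (fun z : X * X => a z.1).
Proof.
move=> [k ak]; apply/continuous_complexP => z e e0.
have k1 : 0 < `|k| + 1 by rewrite ltr_wpDl.
have ek0 : 0 < e / (`|k| + 1) by rewrite divr_gt0.
apply: filterS (nbhsx_ballx (z : (X * X)%type) _ ek0) => w [zw _].
move: zw; rewrite ballEmdist/= => zw.
apply: le_lt_trans (ak _ _) _; rewrite ltcR.
apply: le_lt_trans (_ : (`|k| + 1) * mdist z.1 w.1 < e).
  by rewrite ler_wpM2r ?mdist_ge0// (le_trans (ler_norm _))// lerDl.
by rewrite mulrC -ltr_pdivlMr.
Qed.

(** With [b = a - a z.1], the squared norm of the image of [y] under [b] is the integral of [|b|^2]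
    against the scalar measure of [y], which is carried by [z], where [b] vanishes. *)
Lemma sg_pi_atom (a : X -> R[i]) z y : lipschitz_functions a ->
  P [set z] y = y -> sg_pi G a y = a z.1 *: y.
Proof.
move=> la Py; rewrite (sg_pi_restriction G la).
(* The constant is written as a multiple of 1 so that [rep_scale] and [rep_one] evaluate it. *)
pose c := a z.1; pose b (w : X * X) := a w.1 + (- c) * 1.
have ca := lipschitz_continuous la.
have c1 : continuous_functions (fun _ : X * X => 1 : R[i]).
  exact: continuous_functions_cst.
have cc : continuous_functions (fun w : X * X => (- c) * 1).
  by exact: continuous_functions_cst.
have cb : continuous_functions b by move=> w; apply: cvgD; [exact: ca|exact: cc].
have crep := sg_pi_tilde_rep G.
apply/eqP; rewrite -subr_eq0; apply/eqP/nm_eq0/eqP.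
have := rep_add crep ca cc y; rewrite (rep_scale crep (- c) c1 y).
rewrite (rep_one crep y) scaleNr => <-; rewrite -/b.
rewrite -sqrf_eq0; apply/eqP/complexI; rewrite -(dotxx dotN).
rewrite -(rep_conj crep cb).
have cb' : continuous_functions (fun w => Num.conj (b w)).
  exact: conj_continuous cb.
rewrite -(rep_mul crep cb' cb).
have cbb : continuous_functions (fun w => Num.conj (b w) * b w).
  exact: normsq_continuous cb.
have [mu [muP muE]] := scalar_measureE dotN z0 Psm y.
have mu0 : mu (~` [set z]) = 0%E.
  rewrite muE; last by apply: borel_open; rewrite openC; exact: closed_set1_prod.
  rewrite (spectral_setC dotN z0 Psm _ spectral_setT)// Py subrr.
  by rewrite nm0 expr0n.
rewrite (sg_pi_tilde_integral cbb muP) /cintegral.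
have bz : b z = 0 by rewrite /b mulr1 subrr.
rewrite (Rintegral_concentrated (borel1 z) (Re_continuous cbb) mu0).
have Im0 w : complex.Im ((b w)^* * b w) = 0.
  by rewrite mulrC -normCK ger0_Im// exprn_ge0.
under eq_Rintegral do rewrite Im0.
by rewrite bz mulr0 mul0e/= /Rintegral integral0.
Qed.

End SpectralGeometry.

(** * The isomorphism with the model *)

Section OrthonormalExpansion.
Context {R : realType} {H : completeNormedModType R[i]}.
Variable dot : {dot H for (@Num.conj R[i])}.
Hypothesis dotN : hilbert_dot dot.
Variables (V : set H) (m : nat) (e : nat -> H).
Hypothesis eV : orthonormal_basis dot V m e.

Lemma orthonormal_coef (c : nat -> R[i]) k : (k < m)%N ->
  dot (\sum_(j < m) c j *: e j) (e k) = c k.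
Proof.
move=> km; have [e1 e_orth _] := eV.
rewrite dot_suml (bigD1 (Ordinal km))//= dotZl (dotxx dotN) (e1 k km).2.
rewrite expr1n mulr1 big1 ?addr0// => j jk.
by rewrite dotZl e_orth ?mulr0.
Qed.

Lemma dot_lincomb x (c : nat -> R[i]) :
  (forall k, (k < m)%N -> dot x (e k) = c k) ->
  dot x (\sum_(k < m) c k *: e k) = (\sum_(k < m) complex.Re (`|c k| ^+ 2))%:C.
Proof.
move=> xc; rewrite dot_sumr rmorph_sum; apply: eq_bigr => k _.
rewrite dotZr xc// mulrC -[X in X = _]/(c k * Num.conj (c k)) -normCK.
by apply/esym/RRe_real; rewrite rpredX// normr_real.
Qed.

Lemma nm_lincomb (c : nat -> R[i]) :
  nm (\sum_(k < m) c k *: e k) ^+ 2 = \sum_(k < m) complex.Re (`|c k| ^+ 2).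
Proof.
apply: complexI; rewrite -(dotxx dotN); apply: dot_lincomb => k.
exact: orthonormal_coef.
Qed.

End OrthonormalExpansion.

Section Model.
Context {R : realType} {X : metricType R} {H : completeNormedModType R[i]}.
Variable dot : {dot H for (@Num.conj R[i])}.
Hypothesis dotN : hilbert_dot dot.
Variable G : spectral_geometry X dot.
Variable z0 : X * X.
Local Notation T := (sg_ds G).
Local Notation P := (sg_P G).
Local Notation B := (sg_support G).
Local Notation d z := (mdist z.1 z.2).
Let Tsa := sg_ds_self_adjoint G.
Let Tinj := @sg_ds_injective _ _ _ _ G.

Definition atom (z : X * X) : set H := [set y | P [set z] y = y].

Lemma atom_ds z y : atom z y -> atom (swap_pair z) (T y).
Proof. exact: ds_swap. Qed.

Lemma dist_swap (z : X * X) : d (swap_pair z) = d z.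
Proof. exact: metric_sym. Qed.

Lemma atom_basis z : B z -> exists m e, orthonormal_basis dot (atom z) m e.
Proof.
move=> Bz; apply: finite_orthonormal_basis => [c x Px|f f1 f_orth].
  by rewrite /atom/= linearZ_LR Px.
have dz := support_dist_gt0 Bz.
apply: (orthonormal_eigenseq_false dotN (sg_ds_compact G) Tsa dz (f := f)
  (c := fun=> d z)) => // n; first by case: (f1 n).
by apply: (support_sq_eigen dotN z0) => //; case: (f1 n).
Qed.

(** On the atom of [z], [ds^2] is multiplication by [|z|^2], so [ds / |z|] preserves inner products.
    Maximality is pulled back through [T], which is injective. *)
Lemma orthonormal_basis_ds z m (e : nat -> H) : B z ->
  orthonormal_basis dot (atom z) m e ->
  orthonormal_basis dot (atom (swap_pair z)) m
    (fun k => (d z)^-1%:C *: T (e k)).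
Proof.
move=> Bz [e1 e_orth e_max]; have dz := support_dist_gt0 Bz.
have eT j k : (j < m)%N -> dot ((d z)^-1%:C *: T (e j)) ((d z)^-1%:C *: T (e k)) =
    dot (e j) (e k).
  move=> jm; rewrite dotZl dotZ_real -Tsa (support_sq_eigen dotN z0 Bz (e1 _ jm).1).
  rewrite dotZl !mulrA -!rmorphM/= (_ : _ * _ * _ = 1) ?mul1r//.
  by field; rewrite gt_eqF.
split=> [k km|j k jm km jk|x Px x0].
- split; first by rewrite /atom/= linearZ_LR (atom_ds (e1 _ km).1).
  apply/eqP; rewrite -(@eqrXn2 _ 2)// ?nm_ge0// expr1n; apply/eqP/complexI.
  by rewrite -(dotxx dotN) eT// (dotxx dotN) (e1 _ km).2 expr1n.
- by rewrite eT// e_orth.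
- apply: Tinj; rewrite linear0; apply: e_max => [|k km].
    by have := atom_ds Px; rewrite swap_pairK.
  rewrite Tsa; have := x0 _ km; rewrite dotZ_real => /eqP.
  by rewrite mulf_eq0 (inj_eq (@complexI R) _ 0) invr_eq0 gt_eqF//= => /eqP.
Qed.

(* On each pair [{z, swap_pair z}] the basis is chosen at one of the two points
   and transported to the other one by [ds / |z|]. *)
Lemma symmetric_basis : exists (m : X * X -> nat) (e : X * X -> nat -> H),
  [/\ forall z, m (swap_pair z) = m z,
      forall z, B z -> orthonormal_basis dot (atom z) (m z) (e z) &
      forall z k, B z -> (k < m z)%N ->
        T (e z k) = (d z)%:C *: e (swap_pair z) k].
Proof.
have /choice[m0 /choice[b bP]] (z : X * X) : exists m, exists e,
    B z -> orthonormal_basis dot (atom z) m e.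
  have [/atom_basis[m [e me]]|nB] := pselect (B z); first by exists m, e.
  by exists 0%N, (fun=> 0).
(* The choice depends only on the set of the two points, so both get the same representative, and
   [m] is symmetric. *)
pose rep (z : X * X) := xget z0 [set z; swap_pair z].
have rep_swap z : rep (swap_pair z) = rep z.
  by rewrite /rep swap_pairK setUC.
have repP z : rep z = z \/ rep z = swap_pair z.
  have ex : exists w, [set z; swap_pair z] w by exists z; left.
  exact: (xgetPex z0 ex).
pose e z k := if rep z == z then b z k
  else (d z)^-1%:C *: T (b (swap_pair z) k).
exists (fun z => m0 (rep z)), e; split=> [z|z Bz|z k Bz].
- by rewrite rep_swap.
- rewrite /e; have [rz|rz] := eqVneq (rep z) z.
    by rewrite rz; exact: bP.
  have rs : rep z = swap_pair z by case: (repP z) => // r; rewrite r eqxx in rz.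
  have Bs := support_swap dotN z0 Bz.
  have := orthonormal_basis_ds Bs (bP _ Bs).
  by rewrite swap_pairK dist_swap rs.
- move=> km; have dz := support_dist_gt0 Bz; have Bs := support_swap dotN z0 Bz.
  have zs : z != swap_pair z.
    apply: contraTneq dz; case: z {km Bz Bs} => a c [-> _].
    by rewrite mdistxx ltxx.
  rewrite /e rep_swap; have [rz|rz] := eqVneq (rep z) z.
    rewrite {1}rz (negbTE zs) swap_pairK dist_swap scalerA -rmorphM/=.
    by rewrite mulfV ?gt_eqF// scale1r.
  have rs : rep z = swap_pair z by case: (repP z) => // r; rewrite r eqxx in rz.
  rewrite rs eqxx linearZ_LR.
  have [/(_ k)] := bP _ Bs; rewrite -rs => /(_ km)[Pb _] _ _.
  rewrite (support_sq_eigen dotN z0 _ Pb) ?rs// dist_swap scalerA -rmorphM/=.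
  by rewrite expr2 mulrA mulVf ?gt_eqF// mul1r.
Qed.

(** * The coefficient map and its inverse *)

Section Isomorphism.
Variables (m : X * X -> nat) (e : X * X -> nat -> H).
Hypotheses (m_swap : forall z, m (swap_pair z) = m z)
  (e_basis : forall z, B z -> orthonormal_basis dot (atom z) (m z) (e z))
  (e_ds : forall z k, B z -> (k < m z)%N ->
     T (e z k) = (d z)%:C *: e (swap_pair z) k).

Definition coefficients (x : H) : @sections R X :=
  fun z k => if `[< B z /\ (k < m z)%N >] then dot x (e z k) else 0.

Lemma coefficientsE x z k : B z -> (k < m z)%N ->
  coefficients x z k = dot x (e z k).
Proof. by move=> Bz km; rewrite /coefficients asboolT. Qed.

Lemma coefficients0 x z k : ~ (B z /\ (k < m z)%N) -> coefficients x z k = 0.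
Proof. by move=> nBz; rewrite /coefficients asboolF. Qed.

Lemma coefficients_is_linear : linear coefficients.
Proof.
move=> c x y; apply/funext => z; apply/funext => k.
have -> : (c *: coefficients x + coefficients y) z k =
  c * coefficients x z k + coefficients y z k by [].
rewrite /coefficients; case: asboolP => _; last by rewrite mulr0 addr0.
by rewrite dotDl dotZl.
Qed.

HB.instance Definition _ := GRing.isLinear.Build R[i] H (@sections R X) *:%R
  coefficients coefficients_is_linear.

(** The part that a preimage of [c] under [coefficients] must have in the range of [P [set z]]. *)
Definition component (c : @sections R X) (z : X * X) : H :=
  \sum_(k < m z) c z k *: e z k.

Lemma component_atom c z : B z -> atom z (component c z).
Proof.
move=> Bz; have [e1 _ _] := e_basis Bz.
rewrite /atom/= linear_sum; apply: eq_bigr => k _.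
by rewrite linearZ_LR (e1 k _).1.
Qed.

Lemma component_orthogonal c z w y : B z -> z <> w -> atom w y ->
  dot (component c z) y = 0.
Proof.
by move=> Bz zw; apply: (atoms_orthogonal dotN z0 zw); exact: component_atom.
Qed.

Lemma model_sqnormE c :
  model_sqnorm B m c = \esum_(z in B) (nm (component c z) ^+ 2)%:E.
Proof. by apply: eq_esum => z Bz; rewrite (nm_lincomb dotN (e_basis Bz)). Qed.

(** The projection of [x - y] to each atom is orthogonal to the basis there, hence zero by
    maximality, and the atoms are complete. *)
Lemma coefficients_eq x y : coefficients x = coefficients y -> x = y.
Proof.
move=> xy; apply/eqP; rewrite -subr_eq0; apply/eqP.
apply: (support_complete dotN z0 (G := G)) => z Bz.
have [e1 _ e_max] := e_basis Bz.
have [pz saz] : orthogonal_projector dot (P [set z]).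
  apply: (sm_projector (sg_P_spectral G)); apply: (borel_closed z0).
  exact: closed_set1_prod.
apply: e_max => [|k km]; first exact: pz.
by rewrite saz (e1 k km).1 dotBl -!coefficientsE// xy subrr.
Qed.

(** The preimage is the orthogonal series of the components. Each [e z k] is orthogonal to the
    components at other points, so it reads off [c z k]. *)
Lemma coefficients_onto c : model_space B m c -> exists y,
  coefficients y = c /\ (nm y ^+ 2)%:E = model_sqnorm B m c.
Proof.
move=> [c_sec]; rewrite model_sqnormE => c_fin.
have orth z w : B z -> B w -> z <> w -> dot (component c z) (component c w) = 0.
  by move=> Bz Bw zw; apply: component_orthogonal zw _ => //; exact: component_atom.
have [y [yn yc]] := orthogonal_series dotN orth c_fin; exists y; split=> //.
apply/funext => z; apply/funext => k.
have [[Bz km]|nBz] := pselect (B z /\ (k < m z)%N); last first.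
  by rewrite c_sec// coefficients0.
have [e1 _ _] := e_basis Bz.
rewrite coefficientsE// (yc z)//.
  exact (orthonormal_coef dotN (e_basis Bz) (c z) km).
by move=> w Bw wz; apply: component_orthogonal wz (e1 k km).1.
Qed.

Lemma coefficients_model_space x : model_space B m (coefficients x).
Proof.
split=> [z k|]; first exact: coefficients0.
rewrite model_sqnormE; apply: (@le_lt_trans _ _ (nm x ^+ 2)%:E); last exact: ltry.
apply: (bessel dotN) => z Bz.
  by move=> w Bw zw; apply: component_orthogonal zw _ => //; exact: component_atom.
rewrite (dotxx dotN) (nm_lincomb dotN (e_basis Bz)).
by apply: dot_lincomb => k km; rewrite coefficientsE.
Qed.

(** Parseval: the series rebuilt from the coefficients of [x] has the right norm, and by injectivity
    it is [x]. *)
Lemma coefficients_norm x : model_sqnorm B m (coefficients x) = (nm x ^+ 2)%:E.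
Proof.
have [y [xy <-]] := coefficients_onto (coefficients_model_space x).
by rewrite (coefficients_eq xy).
Qed.

Lemma coefficients_pi (a : X -> R[i]) x : lipschitz_functions a ->
  coefficients (sg_pi G a x) = model_pi a (coefficients x).
Proof.
move=> la; apply/funext => z; apply/funext => k; rewrite /model_pi.
have [[Bz km]|nBz] := pselect (B z /\ (k < m z)%N); last first.
  by rewrite !coefficients0// mulr0.
have [e1 _ _] := e_basis Bz; rewrite !coefficientsE//.
(* The adjoint of the action of [a] is that of its conjugate, which acts on [e z k] as a scalar. *)
pose a' (y : X) := Num.conj (a y).
have la' : lipschitz_functions a'.
  by case: la => K aK; exists K => y y'; rewrite /a' -rmorphB norm_conjC.
have := rep_conj (sg_pi_rep G) la' x (e z k).
rewrite (sg_pi_atom dotN z0 la' (e1 k km).1).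
rewrite (_ : (fun s => _) = a); last by apply/funext => y; rewrite /a' conjCK.
by move=> ->; rewrite dotZr; congr (_ * _); exact: conjCK.
Qed.

Lemma coefficients_ds x : coefficients (T x) = model_ds (coefficients x).
Proof.
apply/funext => z; apply/funext => k; rewrite /model_ds.
have [[Bz km]|nBz] := pselect (B z /\ (k < m z)%N); last first.
  rewrite !coefficients0 ?mulr0// => -[Bs ks]; apply: nBz; split.
    by rewrite -[z]swap_pairK; exact: (support_swap dotN z0).
  by rewrite -m_swap.
have Bs := support_swap dotN z0 Bz.
by rewrite !coefficientsE ?m_swap// Tsa e_ds// dotZ_real.
Qed.

Lemma coefficients_isomorphism :
  model_isomorphism G B m (coefficients : {linear H -> @sections R X}).
Proof.
split.
- apply/seteqP; split=> [_ [x _ <-]|c]; first exact: coefficients_model_space.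
  by move/coefficients_onto => [y [<- _]]; exists y.
- by move=> x; rewrite coefficients_norm (dotxx dotN).
- by move=> a la x; exact: coefficients_pi.
- exact: coefficients_ds.
Qed.

End Isomorphism.

End Model.

Theorem theorem2p6 (R : realType) (X : metricType R)
    (X_compact : compact [set: X])
    (H : completeNormedModType R[i]) (dot : {dot H for (@Num.conj R[i])})
    (H_hilbert : hilbert_dot dot) (G : spectral_geometry X dot) :
  let B := sg_support G in
  [/\ B `<=` ~` diagonal,
      forall y y' : X, B (y, y') <-> B (y', y),
      forall t : R, 0 < t ->
        finite_set [set z : X * X | B z /\ t <= mdist z.1 z.2] &
      exists m : X * X -> nat,
        [/\ forall z, B z -> (0 < m z)%N,
            forall y y' : X, B (y, y') -> m (y, y') = m (y', y) &
            exists U : {linear H -> @sections R X}, model_isomorphism G B m U]].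
Proof.
(* The spectral lemmas take a base point [z0], so an empty space is treated apart. *)
move=> B; have [[z0 _]|noX] := pselect (exists z : X * X, True); last first.
  have nB z : ~ B z by move=> _; apply: noX; exists z.
  (* Over an empty space all functions coincide, so 1 and 0 act alike and the identity of [H] is
     zero. *)
  have H0 (x : H) : x = 0.
    have c1 : continuous_functions (fun _ : X * X => 1 : R[i]).
      exact: continuous_functions_cst.
    have := rep_scale (sg_pi_tilde_rep G) 0 c1 x; rewrite scale0r => <-.
    rewrite -[LHS](rep_one (sg_pi_tilde_rep G) x); congr (sg_pi_tilde G _ x).
    by apply/funext => z; case: noX; exists z.
  have sec0 (c c' : @sections R X) : c = c'.
    by apply/funext => z; case: noX; exists z.
  have BE : B = set0 by apply/seteqP; split=> z // /nB.
  split.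
  - by move=> z /nB.
  - by move=> y y'; split=> /nB.
  - move=> t _; rewrite (_ : [set _ | _] = set0)//.
    by apply/seteqP; split=> z // -[/nB].
  - exists (fun=> 0%N); split; [by move=> z /nB|by []|exists \0].
    split=> //.
    + apply/seteqP; split=> [_ [x _ <-]|c _]; last by exists 0.
      split; first by move=> z; case: noX; exists z.
      by rewrite /model_sqnorm BE esum_set0 ltry.
    + by move=> x; rewrite /model_sqnorm BE esum_set0 [x]H0 dot0l.
split.
- move=> [y y'] Bz yy'; have := support_dist_gt0 Bz.
  by rewrite yy' mdistxx ltxx.
- by move=> y y'; split; exact: (support_swap H_hilbert z0).
- by move=> t t0; exact: (finite_support_ge H_hilbert G z0 t0).
- have [m [e [m_swap e_basis e_ds]]] := symmetric_basis H_hilbert G z0.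
  exists m; split=> [z Bz|y y' _|].
  (* If [m z] were zero, maximality of the empty basis would make every vector of the atom zero. *)
  + have [y y0 Py] := support_atom H_hilbert z0 Bz.
    have [_ _ e_max] := e_basis _ Bz.
    rewrite lt0n; apply: contra y0 => /eqP mz0; apply/eqP/e_max => // k.
    by rewrite mz0.
  + by rewrite -m_swap.
  + by eexists; exact: (coefficients_isomorphism H_hilbert z0 m_swap e_basis e_ds).
Qed.
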